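(* Let $M,M'$ be pointwise finite-dimensional persistence modules indexed over $\mathbb{R}^d$. Then, for any rank decompositions $(\mathcal{R},\mathcal{S})$ and $(\mathcal{R}',\mathcal{S}')$ of the usual rank invariants $\operatorname{Rk}M$ and $\operatorname{Rk}M'$ respectively over all rectangles in $\mathbb{R}^d$, we have \[ \mathrm{d}_{\mathrm{match}}(\mathbf{k}_{\mathcal{R}}\oplus\mathbf{k}_{\mathcal{S}'},\ \mathbf{k}_{\mathcal{R}'}\oplus\mathbf{k}_{\mathcal{S}})\le \mathrm{d}_{\mathrm{i}}(M,M'). \]
   Context: Fix a field $\mathbf{k}$. $\mathbb{R}^d$ carries the product order. A persistence module over $\mathbb{R}^d$ is a functor $M\colon\mathbb{R}^d\to\mathrm{Vec}_{\mathbf{k}}$; it is pointwise finite-dimensional (pfd) if each $M(s)$ is finite-dimensional. The usual rank invariant is $\operatorname{Rk}M(s,t)=\operatorname{rank}[M(s)\to M(t)]$ for $s\le t$. A rectangle is a product of $d$ non-empty intervals of $\mathbb{R}$ (open, closed, half-open, possibly unbounded). For a rectangle $R$, $\mathbf{k}_R$ is the module equal to $\mathbf{k}$ on $R$ and $0$ elsewhere with identity maps inside $R$; for a multi-set $\mathcal{R}$ of rectangles $\mathbf{k}_{\mathcal{R}}=\bigoplus_{R\in\mathcal{R}}\mathbf{k}_R$. A rank decomposition of $\operatorname{Rk}M$ over all rectangles is a pair $(\mathcal{R},\mathcal{S})$ of multi-sets of rectangles such that $\operatorname{Rk}\mathbf{k}_{\mathcal{R}}$ and $\operatorname{Rk}\mathbf{k}_{\mathcal{S}}$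 are finite-valued and $\operatorname{Rk}M=\operatorname{Rk}\mathbf{k}_{\mathcal{R}}-\operatorname{Rk}\mathbf{k}_{\mathcal{S}}$. Matching distance: an upward sloping line $\ell$ is parametrized by $\lambda\mapsto(1-\lambda)s+\lambda t$, $\lambda\in\mathbb{R}$, with $s_i<t_i$ for all $i$; its weight is $\omega(\ell)=\frac{\min_i(t_i-s_i)}{\max_i(t_i-s_i)}$. For pfd modules $M,N$, $\mathrm{d}_{\mathrm{match}}(M,N)=\sup_{\ell}\ \omega(\ell)\,\mathrm{d}_{\mathrm{b}}(M|_\ell,N|_\ell)$, where $\mathrm{d}_{\mathrm{b}}$ is the usual bottleneck distance between (the barcodes of) one-parameter modules, $\ell$ being identified with $\mathbb{R}$ by a parametrization normalized so that $\max_i(t_i-s_i)=1$. $\mathrm{d}_{\mathrm{i}}$ is the usual interleaving distance: $M,N$ are $\varepsilon$-interleaved ($\varepsilon\ge0$) if there are natural morphisms $M\to N[\varepsilon\mathbf{1}]$, $N\to M[\varepsilon\mathbf{1}]$, with $N[v](t)=N(t+v)$ and $\mathbf{1}=(1,\dots,1)$, whose composites (after shifting) are the structure maps $M\to M[2\varepsilon\mathbf{1}]$ and $N\to N[2\varepsilon\mathbf{1}]$; $\mathrm{d}_{\mathrm{i}}(M,N)$ is the infimum of such $\varepsilon$ ($\infty$ if none). *)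

(* Defs.v *)
From HB Require Import structures.
From mathcomp Require Import all_boot all_order all_algebra.
From mathcomp Require Import all_classical all_reals.
From mathcomp Require Import ereal.

Set Implicit Arguments.
Unset Strict Implicit.
Unset Printing Implicit Defensive.

Import Order.TTheory GRing.Theory Num.Theory.

Local Open Scope classical_set_scope.
Local Open Scope ring_scope.

(* Direct sum of an arbitrary (possibly infinite) family of vector spaces:
   the families of finite support. *)
Section DirectSum.
Context (k : fieldType) (I : Type) (V : I -> lmodType k).

Record dsum := DSum {
  dsum_val :> forall i, V i;
  dsum_fin : finite_set [set i | dsum_val i <> 0] }.

Lemma dsum_eq (f g : dsum) : (forall i, f i = g i) -> f = g.
Proof.
case: f g => [f Pf] [g Pg] /= fg.
have {}fg : f = g by exact: functional_extensionality_dep.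
by rewrite fg in Pf *; congr DSum; exact: Prop_irrelevance.
Qed.

HB.instance Definition _ := gen_eqMixin dsum.
HB.instance Definition _ := gen_choiceMixin dsum.

Program Definition dsum0 := @DSum (fun=> 0) _.
Next Obligation.
by apply: (@sub_finite_set _ _ set0) => // i /= /(_ erefl).
Qed.

Program Definition dsum_opp (f : dsum) := @DSum (fun i => - f i) _.
Next Obligation.
move=> f; apply: sub_finite_set (dsum_fin f) => i /= + fi0; apply.
by rewrite fi0 oppr0.
Qed.

Program Definition dsum_add (f g : dsum) := @DSum (fun i => f i + g i) _.
Next Obligation.
move=> f g.
have : finite_set ([set i | f i <> 0] `|` [set i | g i <> 0]).
  by rewrite finite_setU; split; exact: dsum_fin.
apply: sub_finite_set => i /= fgi.
by apply: contrapT => /not_orP[/contrapT fi /contrapT gi]; apply: fgi;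
  rewrite fi gi addr0.
Qed.

Program Definition dsum_scale (a : k) (f : dsum) :=
  @DSum (fun i => a *: f i) _.
Next Obligation.
move=> a f; apply: sub_finite_set (dsum_fin f) => i /= + fi0; apply.
by rewrite fi0 scaler0.
Qed.

Fact dsum_addA : associative dsum_add.
Proof. by move=> f g h; apply: dsum_eq => i /=; rewrite addrA. Qed.
Fact dsum_addC : commutative dsum_add.
Proof. by move=> f g; apply: dsum_eq => i /=; rewrite addrC. Qed.
Fact dsum_add0 : left_id dsum0 dsum_add.
Proof. by move=> f; apply: dsum_eq => i /=; rewrite add0r. Qed.
Fact dsum_addN : left_inverse dsum0 dsum_opp dsum_add.
Proof. by move=> f; apply: dsum_eq => i /=; rewrite addNr. Qed.

HB.instance Definition _ :=
  GRing.isZmodule.Build dsum dsum_addA dsum_addC dsum_add0 dsum_addN.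

Fact dsum_scaleA a b (f : dsum) :
  dsum_scale a (dsum_scale b f) = dsum_scale (a * b) f.
Proof. by apply: dsum_eq => i /=; rewrite scalerA. Qed.
Fact dsum_scale1 : left_id 1 dsum_scale.
Proof. by move=> f; apply: dsum_eq => i /=; rewrite scale1r. Qed.
Fact dsum_scaleDr : right_distributive dsum_scale +%R.
Proof. by move=> a f g; apply: dsum_eq => i /=; rewrite scalerDr. Qed.
Fact dsum_scaleDl f : {morph dsum_scale^~ f : a b / a + b}.
Proof. by move=> a b; apply: dsum_eq => i /=; rewrite scalerDl. Qed.

HB.instance Definition _ := GRing.Zmodule_isLmodule.Build k dsum
  dsum_scaleA dsum_scale1 dsum_scaleDr dsum_scaleDl.

End DirectSum.

Section DirectSumMap.
Context (k : fieldType) (I : Type) (V W : I -> lmodType k).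
Variable f : forall i, {linear V i -> W i}.

Program Definition dsum_map (x : dsum V) : dsum W :=
  @DSum k I W (fun i => f i (x i)) _.
Next Obligation.
move=> x; apply: sub_finite_set (dsum_fin x) => i /= + xi0; apply.
by rewrite xi0 linear0.
Qed.

Fact dsum_map_is_linear : linear dsum_map.
Proof. by move=> a x y; apply: dsum_eq => i /=; rewrite linearP. Qed.

HB.instance Definition _ :=
  GRing.isLinear.Build k (dsum V) (dsum W) *:%R dsum_map dsum_map_is_linear.

End DirectSumMap.

Section PairMap.
Context (k : fieldType) (V V' W W' : lmodType k).
Variables (f : {linear V -> W}) (f' : {linear V' -> W'}).

Definition pair_map (x : V * V') : W * W' := (f x.1, f' x.2).

Fact pair_map_is_linear : linear pair_map.
Proof. by move=> a x y; rewrite /pair_map /= !linearP. Qed.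

HB.instance Definition _ := GRing.isLinear.Build k (V * V')%type (W * W')%type
  *:%R pair_map pair_map_is_linear.

End PairMap.

Section Rank.
Context (k : fieldType).

(* A is meant to be a linear subspace; linear independence is that of the
   family e, so that repetitions are excluded. *)
Definition has_dim (V : lmodType k) (A : set V) (n : nat) : Prop :=
  exists e : 'I_n -> V,
    [/\ forall i, A (e i),
        forall c : 'I_n -> k, \sum_i c i *: e i = 0 -> forall i, c i = 0
      & forall v, A v -> exists c : 'I_n -> k, v = \sum_i c i *: e i].

Definition finite_dim (V : lmodType k) : Prop := exists n, has_dim [set: V] n.

Definition finite_rank (V W : lmodType k) (f : {linear V -> W}) : Prop :=
  exists n, has_dim (range f) n.

(* Meaningful only if finite_rank f (and 0 otherwise). *)
Definition rank (V W : lmodType k) (f : {linear V -> W}) : nat :=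
  xget 0%N [set n | has_dim (range f) n].

End Rank.

(* Functors from the poset T to k-vector spaces. *)
Record persmod (k : fieldType) (disp : Order.disp_t) (T : porderType disp) :=
  PersMod {
    pob :> T -> lmodType k;
    pmor : forall s t, (s <= t)%O -> {linear pob s -> pob t};
    pmor_id : forall s (h : (s <= s)%O) x, pmor h x = x;
    pmor_comp : forall s t u (st : (s <= t)%O) (tu : (t <= u)%O)
      (su : (s <= u)%O) x, pmor su x = pmor tu (pmor st x) }.

Section PersistenceModules.
Context (k : fieldType) (disp : Order.disp_t) (T : porderType disp).
Implicit Types M N : persmod k T.

Definition pfd M : Prop := forall s, finite_dim (M s).

Record phom M N := PHom {
  phom_val :> forall s, {linear M s -> N s};
  phom_nat : forall s t (st : (s <= t)%O) x,
    phom_val t (pmor M st x) = pmor N st (phom_val s x) }.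

Definition piso M N : Prop := exists f : phom M N, forall s, bijective (f s).

Definition Rk M (s t : T) (st : (s <= t)%O) : nat := rank (pmor M st).

Definition Rk_finite M : Prop :=
  forall (s t : T) (st : (s <= t)%O), finite_rank (pmor M st).

Program Definition padd M N : persmod k T :=
  @PersMod k disp T (fun s => (M s * N s)%type)
    (fun s t st => pair_map (pmor M st) (pmor N st)) _ _.
Next Obligation.
by move=> M N s h [x y] /=; rewrite /pair_map !pmor_id.
Qed.
Next Obligation.
move=> M N s t u st tu su [x y] /=.
by rewrite /pair_map /= (pmor_comp st tu) [X in (_, X)](pmor_comp st tu).
Qed.

Program Definition psum (I : Type) (M : I -> persmod k T) : persmod k T :=
  @PersMod k disp T (fun s => dsum (fun i => M i s))
    (fun s t st => dsum_map (fun i => pmor (M i) st)) _ _.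
Next Obligation.
by move=> I M s h x; apply: dsum_eq => i /=; rewrite pmor_id.
Qed.
Next Obligation.
by move=> I M s t u st tu su x; apply: dsum_eq => i /=; apply: pmor_comp.
Qed.

Definition oconvex (A : set T) : Prop :=
  forall s t u, (s <= t)%O -> (t <= u)%O -> A s -> A u -> A t.

(* The module equal to k on A and 0 elsewhere, realized at s as the space of
   row vectors of length 1 or 0 according to whether s belongs to A. The
   matrix const_mx 1 of size (s \in A) x (t \in A) is the 1 x 1 identity
   matrix if s, t are in A, and has no entry otherwise. *)
Program Definition kmod (A : set T) (cvxA : oconvex A) : persmod k T :=
  @PersMod k disp T (fun s => 'rV[k]_(s \in A))
    (fun s t _ => mulmxr (const_mx 1 : 'M[k]_(s \in A, t \in A))) _ _.
Next Obligation.
move=> A cvxA s _ x /=; case: (s \in A) x => x; last first.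
  by apply/rowP => -[].
by apply/rowP => i; rewrite !mxE big_ord1 !mxE mulr1 !ord1.
Qed.
Next Obligation.
move=> A cvxA s t u st tu _ x /=; rewrite -mulmxA; congr (_ *m _).
apply/matrixP => i j; rewrite !mxE.
have sA : s \in A by case: (s \in A) i => // -[].
have uA : u \in A by case: (u \in A) j => // -[].
have tA : t \in A by rewrite inE; apply: cvxA st tu _ _; rewrite -inE.
rewrite tA (eq_bigr (fun=> 1)); last by move=> l _; rewrite !mxE mulr1.
by rewrite big_ord1.
Qed.

End PersistenceModules.

Arguments Rk {k disp T} M {s t} st.

(* Restriction of a persistence module along an order-preserving map. *)
Program Definition ppull (k : fieldType) (disp disp' : Order.disp_t)
    (S : porderType disp) (T : porderType disp') (phi : S -> T)
    (phi_homo : {homo phi : x y / (x <= y)%O}) (M : persmod k T) :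
    persmod k S :=
  @PersMod k disp S (fun s => M (phi s)) (fun s t st => pmor M (phi_homo _ _ st))
    _ _.
Next Obligation. by move=> *; rewrite pmor_id. Qed.
Next Obligation. by move=> *; apply: pmor_comp. Qed.

(* Multi-sets of elements of T, as families indexed by an arbitrary type. *)
Record multiset (T : Type) := Multiset {
  midx : Type;
  mval :> midx -> T }.

Record nitv (R : realType) := NItv {
  nitv_val :> interval R;
  nitv_neq0 : [set` nitv_val] !=set0 }.

Fact nitv_oconvex (R : realType) (J : nitv R) : oconvex [set` nitv_val J].
Proof.
case: J => -[a b] /= _ s t u st tu /=; rewrite !itv_boundlr => /andP[Js _] /andP[_ Ju].
apply/andP; split.
  by apply: le_trans Js _; rewrite bnd_simp.
by apply: le_trans _ Ju; rewrite bnd_simp.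
Qed.

(* The poset R^d is the type 'I_d -> R, which carries the pointwise order. *)
Definition rect (R : realType) (d : nat) := 'I_d -> nitv R.

Definition rect_set (R : realType) (d : nat) (Q : rect R d) : set ('I_d -> R) :=
  [set s | forall i, s i \in nitv_val (Q i)].

Fact rect_oconvex (R : realType) (d : nat) (Q : rect R d) :
  oconvex (rect_set Q).
Proof.
move=> s t u /lefP st /lefP tu Qs Qu i.
by apply: (nitv_oconvex (st i) (tu i)); [exact: Qs|exact: Qu].
Qed.

Definition krect (R : realType) (k : fieldType) (d : nat)
    (Rs : multiset (rect R d)) : persmod k ('I_d -> R) :=
  psum (fun i => kmod k (@rect_oconvex R d (Rs i))).

Definition kbars (R : realType) (k : fieldType) (B : multiset (nitv R)) :
    persmod k R :=
  psum (fun i => kmod k (@nitv_oconvex R (B i))).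

Definition rank_decomposition (R : realType) (k : fieldType) (d : nat)
    (M : persmod k ('I_d -> R)) (Rs Ss : multiset (rect R d)) : Prop :=
  [/\ Rk_finite (krect k Rs), Rk_finite (krect k Ss)
    & forall (s t : 'I_d -> R) (st : (s <= t)%O),
        (Rk M st)%:Z = (Rk (krect k Rs) st)%:Z - (Rk (krect k Ss) st)%:Z].

Section Bottleneck.
Context (R : realType).
Local Open Scope ereal_scope.

(* Extended reals at distance at most delta, with the convention that an
   infinite value is at distance 0 from itself and +oo from anything else. *)
Definition eclose (delta : R) (x y : \bar R) : Prop :=
  x <= y + delta%:E /\ y <= x + delta%:E.

Definition itv_birth (J : interval R) : \bar R := ereal_of_itv_bound J.1.
Definition itv_death (J : interval R) : \bar R := ereal_of_itv_bound J.2.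

(* sigma is the graph of a partial bijection; matched bars are at l^oo-distance
   at most delta, unmatched bars at distance at most delta from the diagonal. *)
Definition matching (delta : R) (B C : multiset (nitv R))
    (sigma : midx B -> midx C -> Prop) : Prop :=
  [/\ (forall i j j', sigma i j -> sigma i j' -> j = j')
        /\ (forall i i' j, sigma i j -> sigma i' j -> i = i'),
      forall i j, sigma i j ->
        eclose delta (itv_birth (B i)) (itv_birth (C j)) /\
        eclose delta (itv_death (B i)) (itv_death (C j)),
      forall i, (~ exists j, sigma i j) ->
        itv_death (B i) <= itv_birth (B i) + (2 * delta)%:E
    & forall j, (~ exists i, sigma i j) ->
        itv_death (C j) <= itv_birth (C j) + (2 * delta)%:E].

Definition bottleneck (B C : multiset (nitv R)) : \bar R :=
  ereal_inf [set delta%:E | delta in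
    [set delta : R | (0 <= delta)%R /\
      exists sigma : midx B -> midx C -> Prop, matching delta sigma]].

Definition is_barcode (k : fieldType) (M : persmod k R)
    (B : multiset (nitv R)) : Prop := piso M (kbars k B).

(* A pointwise finite-dimensional M : persmod k R has a barcode
   (Crawley-Boevey), which is unique up to a bijection of the index types
   (Krull-Remak-Schmidt-Azumaya); hence all barcodes of M and N give the same
   value and the infimum merely selects it. *)
Definition d_b (k : fieldType) (M N : persmod k R) : \bar R :=
  ereal_inf [set x | exists B C : multiset (nitv R),
    [/\ is_barcode M B, is_barcode N C & x = bottleneck B C]].

End Bottleneck.

Section MatchingDistance.
Context (R : realType) (d : nat).

(* An upward sloping line, with a parametrization. *)
Record uline := ULine {
  uline_src : 'I_d -> R;
  uline_dst : 'I_d -> R;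
  uline_lt : forall i, uline_src i < uline_dst i }.

Implicit Type l : uline.

Definition uline_pt l (x : R) : 'I_d -> R :=
  fun i => (1 - x) * uline_src l i + x * uline_dst l i.

Fact uline_pt_homo l : {homo uline_pt l : x y / (x <= y)%O}.
Proof.
move=> x y xy; apply/lefP => i; rewrite /uline_pt.
have E z : (1 - z) * uline_src l i + z * uline_dst l i =
    uline_src l i + z * (uline_dst l i - uline_src l i).
  by rewrite mulrBl mul1r mulrBr -addrA; congr (_ + _); rewrite addrC.
by rewrite !E lerD2l ler_wpM2r// subr_ge0 ltW// uline_lt.
Qed.

(* The slopes are positive, so the default value 0 does not affect the maximum;
   nor does the default value uline_max l affect the minimum. *)
Definition uline_max l : R :=
  \big[Num.max/0]_(i < d) (uline_dst l i - uline_src l i).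
Definition uline_min l : R :=
  \big[Num.min/uline_max l]_(i < d) (uline_dst l i - uline_src l i).
Definition uline_weight l : R := uline_min l / uline_max l.

Definition prestrict (k : fieldType) l (M : persmod k ('I_d -> R)) :
  persmod k R := ppull (@uline_pt_homo l) M.

(* Each line has normalized parametrizations, any two of which differ by a
   translation of the parameter, under which d_b is invariant. *)
Definition d_match (k : fieldType) (M N : persmod k ('I_d -> R)) : \bar R :=
  ereal_sup
    [set ((uline_weight l)%:E * d_b (prestrict l M) (prestrict l N))%E
    | l in [set l | uline_max l = 1]].

End MatchingDistance.

Section InterleavingDistance.
Context (R : realType) (d : nat) (k : fieldType).
Implicit Types M N : persmod k ('I_d -> R).

Definition translate (v t : 'I_d -> R) : 'I_d -> R := fun i => t i + v i.

Fact translate_homo v : {homo translate v : s t / (s <= t)%O}.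
Proof. by move=> s t /lefP st; apply/lefP => i; rewrite lerD2r. Qed.

Definition pshift (v : 'I_d -> R) M : persmod k ('I_d -> R) :=
  ppull (@translate_homo v) M.

Definition diag (e : R) : 'I_d -> R := fun=> e.

(* f : M -> N[e] and g : N -> M[e]; the composites g[e] \o f and f[e] \o g are
   the structure maps M -> M[2e] and N -> N[2e]. *)
Definition interleaved (e : R) M N : Prop :=
  exists (f : phom M (pshift (diag e) N)) (g : phom N (pshift (diag e) M)),
    (forall s (h : (s <= translate (diag e) (translate (diag e) s))%O) x,
       g (translate (diag e) s) (f s x) = pmor M h x) /\
    (forall s (h : (s <= translate (diag e) (translate (diag e) s))%O) x,
       f (translate (diag e) s) (g s x) = pmor N h x).

Definition d_i M N : \bar R :=
  ereal_inf [set e%:E | e in [set e : R | 0 <= e /\ interleaved e M N]].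

End InterleavingDistance.

(* Main.v *)
Require Import Defs.
From HB Require Import structures.
From mathcomp Require Import all_boot all_order all_algebra.
From mathcomp Require Import all_classical all_reals.
From mathcomp Require Import ereal normed_module.
From mathcomp Require Import finmap.
From mathcomp Require Import zify lra ring.

Set Implicit Arguments.
Unset Strict Implicit.
Unset Printing Implicit Defensive.

Import Order.TTheory GRing.Theory Num.Theory.

(** On an upward line the rectangles restrict to bars, so the bars of
    [k_R (+) k_S'] and of [k_R' (+) k_S] are explicit, and the number of them
    containing two points [s <= t] is the rank of [M (+) k_S (+) k_S'],
    respectively [M' (+) k_S (+) k_S']. Interleaved modules stay interleaved
    after adding the same summands, so it is enough to match two families of
    bars that count the ranks of two delta-interleaved modules [M] and [N] over
    [R]. No barcode of [M] or [N] is needed.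

    Restrict to a finite grid and let [q s t] be the rank of
    [M s -> N (t + delta)], the rank function of the image of [M -> N(delta)].
    By the Frobenius inequality, [q] has a barcode on the grid; among the bars
    starting at a given grid point, the ones of [q] are dominated by those of
    [M], and dominate those of [M] once these are shortened by [2 delta]. The
    same holds for [q] and [N(delta)] with a given end point. Matching sorted
    bars on both sides and composing gives, as in the induced matching theorem
    of Bauer and Lesnick, a matching of the bars of [M] and [N] seen by the
    grid. A wide and fine grid matches any finite set of long bars, and an
    ultrafilter on the finite sets of bars assembles these finite matchings. *)

(** * Sorted matchings in classes *)

Definition partial_bij (T U : Type) (r : T -> U -> Prop) : Prop :=
  (forall x y y', r x y -> r x y' -> y = y') /\
  (forall x x' y, r x y -> r x' y -> x = x').

(** The second relation is taken backwards because both matchings will end in the barcode of the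
    intermediate module. *)
Lemma partial_bij_comp (T U V : Type) (r : T -> U -> Prop) (s : V -> U -> Prop) :
  partial_bij r -> partial_bij s ->
  partial_bij (fun x z => exists2 y, r x y & s z y).
Proof.
move=> [r1 r2] [s1 s2]; split.
  by move=> x z z' [y rxy szy] [y' /(r1 _ _ _ rxy) <-] /(s2 _ _ _ szy).
move=> x x' z [y rxy szy] [y' + /(s1 _ _ _ szy) yy'].
by rewrite -yy' => /(r2 _ _ _ rxy).
Qed.

Section ClassRank.
Variables (P : finType) (cl v : P -> nat).

(* Ties are broken arbitrarily. *)
Definition class_before (x p : P) : bool :=
  (v p < v x) || ((v x == v p) && (enum_rank x < enum_rank p)).

(** Position of [p] in its class by decreasing [v], starting from 0. *)
Definition class_rank (p : P) : nat :=
  #|[pred x | (cl x == cl p) && class_before x p]|.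

Lemma class_before_lt x y : cl x = cl y -> class_before x y ->
  class_rank x < class_rank y.
Proof.
move=> cxy xy; apply: proper_card; apply/properP; split.
  apply/fintype.subsetP => z; rewrite !inE cxy => /andP[-> /=].
  by move: xy; rewrite /class_before; lia.
by exists x; rewrite !inE cxy eqxx // /class_before; lia.
Qed.

Lemma class_rank_inj x y : cl x = cl y -> class_rank x = class_rank y -> x = y.
Proof.
move=> cxy rxy; apply/eqP/negPn/negP => nxy.
have : enum_rank x != enum_rank y by rewrite (inj_eq enum_rank_inj).
have := @class_before_lt x y cxy; have := @class_before_lt y x (esym cxy).
rewrite rxy ltnn /class_before -val_eqE /=; lia.
Qed.

(** Everything before [p] has value at least [v p], and so has [p] itself, which the rank omits.
    With [class_rank_ge], this turns comparisons of counts into comparisons of values. *)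
Lemma class_rank_lt p :
  class_rank p < #|[pred x | (cl x == cl p) && (v p <= v x)]|.
Proof.
apply: proper_card; apply/properP; split.
  apply/fintype.subsetP => z; rewrite !inE => /andP[-> /=].
  by rewrite /class_before; lia.
by exists p; rewrite !inE eqxx /class_before; lia.
Qed.

Lemma class_rank_ge p x : v p < x ->
  #|[pred y | (cl y == cl p) && (x <= v y)]| <= class_rank p.
Proof.
move=> vpx; apply/subset_leq_card/fintype.subsetP => z; rewrite !inE => /andP[-> /=].
by rewrite /class_before; lia.
Qed.

(** The rank injects a class into an ordinal of the same cardinality, hence is onto. *)
Lemma class_rank_surj c k : k < #|[pred x | cl x == c]| ->
  exists2 p, cl p = c & class_rank p = k.
Proof.
set A := [pred x | cl x == c] => kA.
have rlt (x : {x | x \in A}) : class_rank (val x) < #|A|.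
  apply: leq_trans (class_rank_lt _) _; apply/subset_leq_card/fintype.subsetP => z.
  by case: x => x /=; rewrite !inE => /eqP -> /andP[].
pose f (x : {x | x \in A}) : 'I_#|A| := Ordinal (rlt x).
have finj : injective f.
  move=> [x xA] [y yA] [/= rxy]; apply: val_inj => /=.
  by apply: class_rank_inj => //; move: xA yA; rewrite !inE => /eqP -> /eqP ->.
have /inj_card_onto : #|{: {x | x \in A}}| >= #|'I_#|A| |.
  by rewrite card_ord card_sig.
move=> /(_ _ finj (Ordinal kA)) /codomP[[x xA] /(congr1 val) /= ->].
by exists x => //; apply/eqP; rewrite inE in xA.
Qed.

End ClassRank.

Section ClassMatching.
Variables (P Q : finType) (cl v : P -> nat) (cl' v' : Q -> nat) (L : nat).
Hypothesis le_QP : forall c x, #|[pred q | (cl' q == c) && (x <= v' q)]| <=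
                               #|[pred p | (cl p == c) && (x <= v p)]|.
Hypothesis le_PQ : forall c x, #|[pred p | (cl p == c) && (x + L <= v p)]| <=
                               #|[pred q | (cl' q == c) && (x <= v' q)]|.

(* In each class, the k-th largest element of P is matched with the k-th
   largest element of Q. *)
Lemma class_matching : exists tau : P -> Q -> Prop,
  [/\ partial_bij tau,
      forall p q, tau p q -> [/\ cl p = cl' q, v' q <= v p & v p <= v' q + L],
      forall q, exists p, tau p q
    & forall p, L <= v p -> exists q, tau p q].
Proof.
exists (fun p q => cl p = cl' q /\ class_rank cl v p = class_rank cl' v' q).
split; first split.
- move=> p q q' [c r] [c' r']; apply: (@class_rank_inj _ cl' v').
    by rewrite -c -c'.
  by rewrite -r -r'.
- move=> p p' q [c r] [c' r']; apply: (@class_rank_inj _ cl v).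
    by rewrite c c'.
  by rewrite r r'.
(* If [v p < v' q], the values at least [v' q] number at most the common rank in [P] but more than
   it in [Q], against [le_QP]. The other bound is the same with threshold [v p - L] and [le_PQ]. *)
- move=> p q [cpq rpq]; split => //; rewrite leqNgt; apply/negP => lt.
    have := class_rank_lt cl' v' q; have := le_QP (cl' q) (v' q).
    by have := class_rank_ge cl lt; rewrite cpq rpq; lia.
  have := class_rank_lt cl v p; have := le_PQ (cl p) (v p - L).
  have lt' : v' q < v p - L by lia.
  rewrite subnK; last by lia.
  by have := class_rank_ge cl' lt'; rewrite cpq rpq; lia.
- move=> q; have : class_rank cl' v' q < #|[pred x | cl x == cl' q]|.
    apply: leq_trans (class_rank_lt _ _ _) _; apply: leq_trans (le_QP _ _) _.
    by apply/subset_leq_card/fintype.subsetP => z; rewrite !inE => /andP[].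
  by move=> /(class_rank_surj v)[p cp rp]; exists p.
- move=> p vp; have : class_rank cl v p < #|[pred x | cl' x == cl p]|.
    apply: leq_trans (class_rank_lt _ _ _) _.
    have := le_PQ (cl p) (v p - L); rewrite subnK // => /leq_trans; apply.
    by apply/subset_leq_card/fintype.subsetP => z; rewrite !inE => /andP[].
  by move=> /(class_rank_surj v')[q cq rq]; exists q; rewrite cq rq.
Qed.

End ClassMatching.

(** * Matching the bars of a grid *)

Lemma card_pred_split (T : finType) (A B C : pred T) :
  (forall x, A x = B x || C x) -> (forall x, ~~ (B x && C x)) ->
  #|[pred x | A x]| = #|[pred x | B x]| + #|[pred x | C x]|.
Proof.
move=> ABC BC; rewrite -(cardID B [pred x | A x]).
congr (_ + _); apply: eq_card => x; have := BC x; rewrite !inE /= ABC.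
  by case: (B x); case: (C x).
by change (x \in B) with (B x); case: (B x); case: (C x).
Qed.

Section GridMatching.
Variables (P P' : finType) (fi la : P -> nat) (fi' la' : P' -> nat).
Variables (n L : nat) (q : nat -> nat -> nat).
(* The grid points are 1, ..., n: a bar is labelled by the first and the last grid
   point that it contains, while 0 and n.+1 stand for -oo and +oo. *)
Hypothesis fila : forall p, 0 < fi p <= la p /\ la p <= n.
Hypothesis fila' : forall p, 0 < fi' p <= la' p /\ la' p <= n.

Let b i j := #|[pred p | (fi p <= i) && (j <= la p)]|.
Let c i j := #|[pred p | (fi' p <= i) && (j <= la' p)]|.

Hypothesis q0 : forall j, q 0 j = 0.
Hypothesis qn : forall i, q i n.+1 = 0.
(** The Frobenius inequality on the grid; it makes the multiplicities [mu] below exact in spite of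
    truncated subtraction. *)
Hypothesis q_box : forall i j, 0 < i <= j -> j <= n ->
  q i.-1 j + q i j.+1 <= q i j + q i.-1 j.+1.
(** [qb] and [bq] compare the bars of [q] and of [P] that start exactly at [i], by how far they
    reach; [qc] and [cq] compare those of [q] and of [P'] that end exactly at [j]. Differences of
    ranks are moved across to stay within the naturals. *)
Hypothesis qb : forall i j, 0 < i <= j -> j <= n ->
  q i j + b i.-1 j <= b i j + q i.-1 j.
Hypothesis bq : forall i j, 0 < i <= j -> j <= n ->
  b i (j + L) + q i.-1 j <= q i j + b i.-1 (j + L).
Hypothesis qc : forall i j, 0 < i <= j -> j <= n ->
  q i j + c i j.+1 <= c i j + q i j.+1.
Hypothesis cq : forall i j, 0 < i <= j -> j <= n ->
  c (i - L) j + q i j.+1 <= q i j + c (i - L) j.+1.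

(** Moebius inversion of the rank function: the multiplicity of the bar from [i] to [j]. *)
Let mu i j :=
  if (0 < i <= j) && (j <= n) then
    (q i j + q i.-1 j.+1) - (q i.-1 j + q i j.+1) else 0.

(* The barcode of the intermediate module with rank function q. *)
Let QT : finType := {x : 'I_n.+1 * 'I_n.+1 & 'I_(mu x.1 x.2)}.
Let bi (x : QT) : nat := (tag x).1.
Let de (x : QT) : nat := (tag x).2.

Let bide x : 0 < bi x <= de x /\ de x <= n.
Proof.
case: x => -[i j] k; rewrite /bi /de /=.
have : 0 < mu i j by apply: leq_ltn_trans (ltn_ord k).
by rewrite /mu; case: ifP => // /andP[].
Qed.

Let card_mu i j : #|[pred x | (bi x == i) && (de x == j)]| = mu i j.
Proof.
have [ijn|ijn] := boolP ((i < n.+1) && (j < n.+1)); last first.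
  have -> : mu i j = 0 by rewrite /mu; case: ifP => //; lia.
  apply: eq_card0 => x; rewrite !inE; apply/negbTE.
  by have := bide x; lia.
case/andP: ijn => ilt jlt.
pose ij := (Ordinal ilt, Ordinal jlt).
have -> : mu i j = #|'I_(mu ij.1 ij.2)| by rewrite card_ord.
pose tag_ij (k : 'I_(mu ij.1 ij.2)) : QT :=
  Tagged (fun x : 'I_n.+1 * 'I_n.+1 => 'I_(mu x.1 x.2)) k.
rewrite -(@fintype.card_image _ _ tag_ij).
  apply: eq_card => x; rewrite inE; apply/idP/fintype.imageP.
    case: x => -[i' j'] k; rewrite /bi /de /= => /andP[/eqP ii /eqP jj].
    have E : ij = (i', j') by congr pair; apply: val_inj.
    by move: k; rewrite -E => k; exists k.
  by case=> k _ ->; rewrite /bi /de /= !eqxx.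
by move=> k k' /eqP; rewrite eq_Tagged /= => /eqP.
Qed.

(** The multiplicities telescope over the right end, going down from [n.+1] where [q] vanishes. *)
Let card_bi i m : m <= n -> 0 < i <= n.+1 - m ->
  #|[pred x | (bi x == i) && (n.+1 - m <= de x)]| + q i.-1 (n.+1 - m)
  = q i (n.+1 - m).
Proof.
elim: m => [|m IH] mn im.
  rewrite subn0 !qn addn0; apply: eq_card0 => x; rewrite !inE.
  by have := bide x; lia.
have E : (n.+1 - m.+1).+1 = n.+1 - m by lia.
rewrite (@card_pred_split _ _ (fun x => (bi x == i) && (de x == n.+1 - m.+1))
  (fun x => (bi x == i) && (n.+1 - m <= de x))) ; try by move=> x; lia.
rewrite card_mu; have := IH (ltnW mn); have := @q_box i (n.+1 - m.+1).
by rewrite /mu E; case: ifP; lia.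
Qed.

(** The multiplicities telescope over the left end, going up from 0 where [q] vanishes. *)
Let card_de m j : m < j -> j <= n ->
  #|[pred x | (de x == j) && (bi x <= m.+1)]| + q m.+1 j.+1 = q m.+1 j.
Proof.
elim: m => [|m IH] mj jn.
  rewrite (eq_card (B := [pred x | (bi x == 1) && (de x == j)])); last first.
    by move=> x; rewrite !inE; have := bide x; lia.
  rewrite card_mu; have := @q_box 1 j.
  by rewrite /mu /= !q0; case: ifP; lia.
rewrite (@card_pred_split _ _ (fun x => (bi x == m.+2) && (de x == j))
  (fun x => (de x == j) && (bi x <= m.+1))); try by move=> x; lia.
rewrite card_mu; have := IH (ltnW mj) jn; have := @q_box m.+2 j.
by rewrite /mu /=; case: ifP; lia.
Qed.

Let card_fi i j : 0 < i ->
  b i j = #|[pred p | (fi p == i) && (j <= la p)]| + b i.-1 j.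
Proof. by move=> i0; apply: card_pred_split => x; lia. Qed.

Let card_la i j :
  c i j = #|[pred p | (la' p == j) && (fi' p <= i)]| + c i j.+1.
Proof. by apply: card_pred_split => x; lia. Qed.

Lemma grid_matching : exists sigma : P -> P' -> Prop,
  [/\ partial_bij sigma,
      forall p p', sigma p p' ->
        fi' p' <= fi p <= fi' p' + L /\ la' p' <= la p <= la' p' + L,
      forall p, fi p + L <= la p -> exists p', sigma p p'
    & forall p', fi' p' + L <= la' p' -> exists p, sigma p p'].
Proof.
(* Classes are bars with the same start, valued by their length; a length of at least [x] means
   reaching [i + x]. *)
have [] := @class_matching P QT fi (fun p => la p - fi p)
    bi (fun x => de x - bi x) L.
- move=> i x; have [ix|ix] := boolP ((0 < i) && (i + x <= n)); last first.
    rewrite eq_card0 // => y; rewrite !inE; have := bide y; lia.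
  have := @card_bi i (n.+1 - (i + x)); have := @qb i (i + x).
  have := @card_fi i (i + x).
  rewrite (_ : n.+1 - (n.+1 - _) = i + x); last by lia.
  have -> : #|[pred y | (bi y == i) && (x <= de y - bi y)]| =
            #|[pred y | (bi y == i) && (i + x <= de y)]|.
    by apply: eq_card => y; rewrite !inE; have := bide y; lia.
  have -> : #|[pred y | (fi y == i) && (x <= la y - fi y)]| =
            #|[pred y | (fi y == i) && (i + x <= la y)]|.
    by apply: eq_card => y; rewrite !inE; have := fila y; lia.
  lia.
- move=> i x; have [ix|ix] := boolP ((0 < i) && (i + x <= n)); last first.
    rewrite eq_card0 // => y; rewrite !inE; have := fila y; lia.
  have := @card_bi i (n.+1 - (i + x)); have := @bq i (i + x).
  have := @card_fi i (i + x + L).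
  rewrite (_ : n.+1 - (n.+1 - _) = i + x); last by lia.
  have -> : #|[pred y | (bi y == i) && (x <= de y - bi y)]| =
            #|[pred y | (bi y == i) && (i + x <= de y)]|.
    by apply: eq_card => y; rewrite !inE; have := bide y; lia.
  have -> : #|[pred y | (fi y == i) && (x + L <= la y - fi y)]| =
            #|[pred y | (fi y == i) && (i + x + L <= la y)]|.
    by apply: eq_card => y; rewrite !inE; have := fila y; lia.
  lia.
move=> tau [tau_bij tauE tau_q tau_p].
(* Now classes are bars with the same end. *)
have [] := @class_matching P' QT la' (fun p => la' p - fi' p)
    de (fun x => de x - bi x) L.
- move=> j x; have [jx|jx] := boolP ((x < j) && (j <= n)); last first.
    rewrite eq_card0 // => y; rewrite !inE; have := bide y; lia.
  have := @card_de (j - x).-1 j; have := @qc (j - x) j.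
  have := @card_la (j - x) j.
  rewrite (_ : (j - x).-1.+1 = j - x); last by lia.
  have -> : #|[pred y | (de y == j) && (x <= de y - bi y)]| =
            #|[pred y | (de y == j) && (bi y <= j - x)]|.
    by apply: eq_card => y; rewrite !inE; have := bide y; lia.
  have -> : #|[pred y | (la' y == j) && (x <= la' y - fi' y)]| =
            #|[pred y | (la' y == j) && (fi' y <= j - x)]|.
    by apply: eq_card => y; rewrite !inE; have := fila' y; lia.
  lia.
- move=> j x; have [jx|jx] := boolP ((x < j) && (j <= n)); last first.
    rewrite eq_card0 // => y; rewrite !inE; have := fila' y; lia.
  have := @card_de (j - x).-1 j; have := @cq (j - x) j.
  have := @card_la (j - x - L) j.
  rewrite (_ : (j - x).-1.+1 = j - x); last by lia.
  have -> : #|[pred y | (de y == j) && (x <= de y - bi y)]| =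
            #|[pred y | (de y == j) && (bi y <= j - x)]|.
    by apply: eq_card => y; rewrite !inE; have := bide y; lia.
  have -> : #|[pred y | (la' y == j) && (x + L <= la' y - fi' y)]| =
            #|[pred y | (la' y == j) && (fi' y <= j - x - L)]|.
    by apply: eq_card => y; rewrite !inE; have := fila' y; lia.
  lia.
move=> tau' [tau'_bij tau'E tau'_q tau'_p].
(* The first matching keeps starts and moves ends by at most [L], the second keeps ends and moves
   starts. Every intermediate bar is matched on both sides, so composing loses no bar. *)
exists (fun p p' => exists2 x, tau p x & tau' p' x); split.
- exact: partial_bij_comp.
- move=> p p' [x /tauE[] + + + /tau'E[]].
  by have := fila p; have := fila' p'; have := bide x; lia.
- move=> p pL; have [|x px] := tau_p p; first by have := fila p; lia.
  by have [p' p'x] := tau'_q x; exists p', x.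
- move=> p' pL; have [|x px] := tau'_p p'; first by have := fila' p'; lia.
  by have [p p'x] := tau_q x; exists p, x.
Qed.

End GridMatching.

Local Open Scope classical_set_scope.
Local Open Scope ring_scope.

(** * Ranks and the Frobenius inequality *)

Section Combination.
Context (k : fieldType) (V : lmodType k) (n : nat) (e : 'I_n -> V).

(** Coefficients in a row vector give access to the rank theory of matrices. *)
Definition lincomb (u : 'rV[k]_n) : V := \sum_i u 0 i *: e i.

Fact lincomb_is_linear : linear lincomb.
Proof.
move=> a u v; rewrite /lincomb scaler_sumr -big_split; apply: eq_bigr => i _ /=.
by rewrite !mxE scalerDl scalerA.
Qed.

HB.instance Definition _ :=
  GRing.isLinear.Build k 'rV[k]_n V *:%R lincomb lincomb_is_linear.

Lemma lincomb_sum (c : 'I_n -> k) :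
  \sum_i c i *: e i = lincomb (\row_i c i).
Proof. by apply: eq_bigr => i _; rewrite mxE. Qed.

End Combination.

Section Rank.
Context (k : fieldType).
Implicit Types V W : lmodType k.

Lemma has_dimP V (A : set V) n : has_dim A n <-> exists e : 'I_n -> V,
  [/\ forall i, A (e i), forall u, lincomb e u = 0 -> u = 0
    & forall v, A v -> exists u, v = lincomb e u].
Proof.
split=> -[e [eA e_free e_span]]; exists e; split=> //.
- by move=> u u0; apply/rowP => i; rewrite mxE (e_free (u 0)).
- by move=> v /e_span[c ->]; exists (\row_i c i); rewrite lincomb_sum.
- move=> c; rewrite lincomb_sum => /e_free/rowP c0 i.
  by have := c0 i; rewrite !mxE.
- by move=> v /e_span[u ->]; exists (u 0).
Qed.

Lemma lincomb_mulmx V m n (e : 'I_n -> V) (X : 'M[k]_(m, n)) (u : 'rV[k]_m) :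
  lincomb (fun i => lincomb e (row i X)) u = lincomb e (u *m X).
Proof.
by rewrite mulmx_sum_row linear_sum; apply: eq_bigr => i _; rewrite linearZ.
Qed.

Lemma row_free_mul0 m n (X : 'M[k]_(m, n)) :
  (forall u : 'rV_m, u *m X = 0 -> u = 0) -> row_free X.
Proof.
move=> X0; rewrite -kermx_eq0; apply/eqP/row_matrixP => i.
by rewrite row0; apply: X0; rewrite -row_mul mulmx_ker row0.
Qed.

(** The coordinates of one basis in the other form a row-free matrix. *)
Lemma has_dim_leq V (A : set V) m n : has_dim A m -> has_dim A n -> (m <= n)%N.
Proof.
move=> /has_dimP[e [eA e_free _]] /has_dimP[f [_ _ f_span]].
have /choice[g gE] : forall i, exists u, e i = lincomb f u.
  by move=> i; apply/f_span/eA.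
pose X := \matrix_i g i.
have E u : lincomb e u = lincomb f (u *m X).
  rewrite -lincomb_mulmx; apply: eq_bigr => i _.
  by rewrite gE rowK.
suff /eqP <- : row_free X by exact: rank_leq_col.
by apply: row_free_mul0 => u uX; apply: e_free; rewrite E uX linear0.
Qed.

Lemma has_dim_uniq V (A : set V) m n : has_dim A m -> has_dim A n -> m = n.
Proof. by move=> Am An; apply/eqP; rewrite eqn_leq !(has_dim_leq (A := A)). Qed.

Lemma has_dim_rank V W (f : {linear V -> W}) n :
  has_dim (range f) n -> rank f = n.
Proof.
by move=> fn; apply: (has_dim_uniq _ fn); rewrite /rank; case: xgetP => // /(_ n).
Qed.

Definition represents V W m n (e : 'I_m -> V) (f : 'I_n -> W)
    (F : 'M[k]_(m, n)) (phi : V -> W) : Prop :=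
  forall u, phi (lincomb e u) = lincomb f (u *m F).

Definition is_basis V n (e : 'I_n -> V) : Prop :=
  (forall u, lincomb e u = 0 -> u = 0) /\ (forall v, exists u, v = lincomb e u).

Lemma finite_dim_basis V : finite_dim V -> exists n (e : 'I_n -> V), is_basis e.
Proof.
move=> [n /has_dimP[e [_ e_free e_span]]]; exists n, e.
by split => // v; exact: e_span.
Qed.

Lemma represents_ex V W m n (e : 'I_m -> V) (f : 'I_n -> W)
  (phi : {linear V -> W}) : is_basis f -> exists F, represents e f F phi.
Proof.
move=> [_ f_span]; have /choice[g gE] i := f_span (phi (e i)).
exists (\matrix_i g i) => u; rewrite -lincomb_mulmx linear_sum.
by apply: eq_bigr => i _; rewrite linearZ gE rowK.
Qed.

(** A row base of [F], read in the basis [f], is a basis of the image. *)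
Lemma rank_represents V W m n (e : 'I_m -> V) (f : 'I_n -> W) F
    (phi : {linear V -> W}) :
  is_basis e -> is_basis f -> represents e f F phi -> rank phi = \rank F.
Proof.
move=> [e_free e_span] [f_free f_span] phiF; apply/has_dim_rank/has_dimP.
exists (fun i => lincomb f (row i (row_base F))); split.
- move=> i; have /submxP[D ->] : (row i (row_base F) <= F)%MS.
    by rewrite -(eq_row_base F) row_sub.
  by exists (lincomb e D); rewrite // phiF.
- move=> u; rewrite lincomb_mulmx => /f_free uF.
  by apply: (row_free_inj (row_base_free F)); rewrite uF mul0mx.
- move=> _ [v _ <-]; have [u ->] := e_span v; rewrite phiF.
  have /submxP[D ->] : (u *m F <= row_base F)%MS by rewrite eq_row_base submxMl.
  by exists D; rewrite lincomb_mulmx.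
Qed.

Lemma represents_comp V1 V2 V3 n1 n2 n3 (e1 : 'I_n1 -> V1) (e2 : 'I_n2 -> V2)
    (e3 : 'I_n3 -> V3) F G (phi : V1 -> V2) (psi : V2 -> V3) chi :
  represents e1 e2 F phi -> represents e2 e3 G psi ->
  (forall x, chi x = psi (phi x)) -> represents e1 e3 (F *m G) chi.
Proof. by move=> HF HG chiE u; rewrite chiE HF HG mulmxA. Qed.

Lemma finite_dim_rank_id V (phi : {linear V -> V}) :
  (forall x, phi x = x) -> finite_rank phi -> finite_dim V.
Proof.
move=> phiE [n phin]; exists n; suff <- : range phi = [set: V] by [].
by apply/seteqP; split => // x _; exists x.
Qed.

(** Reduces to matrices. The composites are separate maps with pointwise equations, as structure
    maps of a persistence module compose only up to such equations. *)
Lemma rank_Frobenius V1 V2 V3 V4 (f : {linear V1 -> V2}) (g : {linear V2 -> V3})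
    (h : {linear V3 -> V4}) (gf : {linear V1 -> V3}) (hg : {linear V2 -> V4})
    (hgf : {linear V1 -> V4}) :
  finite_dim V1 -> finite_dim V2 -> finite_dim V3 -> finite_dim V4 ->
  (forall x, gf x = g (f x)) -> (forall x, hg x = h (g x)) ->
  (forall x, hgf x = h (g (f x))) ->
  (rank gf + rank hg <= rank g + rank hgf)%N.
Proof.
move=> /finite_dim_basis[n1 [e1 b1]] /finite_dim_basis[n2 [e2 b2]].
move=> /finite_dim_basis[n3 [e3 b3]] /finite_dim_basis[n4 [e4 b4]] gfE hgE hgfE.
have [F HF] := represents_ex e1 f b2; have [G HG] := represents_ex e2 g b3.
have [H HH] := represents_ex e3 h b4.
have HGF := represents_comp HF HG gfE; have HHG := represents_comp HG HH hgE.
have HHGF : represents e1 e4 (F *m G *m H) hgf.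
  by apply: represents_comp HGF HH _ => x; rewrite hgfE gfE.
rewrite (rank_represents b1 b3 HGF) (rank_represents b2 b4 HHG).
rewrite (rank_represents b2 b3 HG) (rank_represents b1 b4 HHGF).
exact: mxrank_Frobenius.
Qed.

Lemma rank_comp_lel V1 V2 V3 (f : {linear V1 -> V2}) (g : {linear V2 -> V3})
    (gf : {linear V1 -> V3}) :
  finite_dim V1 -> finite_dim V2 -> finite_dim V3 ->
  (forall x, gf x = g (f x)) -> (rank gf <= rank f)%N.
Proof.
move=> /finite_dim_basis[n1 [e1 b1]] /finite_dim_basis[n2 [e2 b2]].
move=> /finite_dim_basis[n3 [e3 b3]] gfE.
have [F HF] := represents_ex e1 f b2; have [G HG] := represents_ex e2 g b3.
rewrite (rank_represents b1 b3 (represents_comp HF HG gfE)).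
by rewrite (rank_represents b1 b2 HF) mxrankM_maxl.
Qed.

Lemma rank_comp_ler V1 V2 V3 (f : {linear V1 -> V2}) (g : {linear V2 -> V3})
    (gf : {linear V1 -> V3}) :
  finite_dim V1 -> finite_dim V2 -> finite_dim V3 ->
  (forall x, gf x = g (f x)) -> (rank gf <= rank g)%N.
Proof.
move=> /finite_dim_basis[n1 [e1 b1]] /finite_dim_basis[n2 [e2 b2]].
move=> /finite_dim_basis[n3 [e3 b3]] gfE.
have [F HF] := represents_ex e1 f b2; have [G HG] := represents_ex e2 g b3.
rewrite (rank_represents b1 b3 (represents_comp HF HG gfE)).
by rewrite (rank_represents b2 b3 HG) mxrankM_maxr.
Qed.

End Rank.

(** * Rank of a sum of interval modules *)

(** Cardinality in an arbitrary type, since index types of multi-sets carry no structure. *)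
Definition enumerates (T : Type) (D : set T) (n : nat) : Prop :=
  exists2 h : 'I_n -> T, injective h & forall x, D x <-> exists i, x = h i.

Lemma uniq_tnth_inj (T : eqType) (s : seq T) :
  uniq s -> injective (tnth (in_tuple s)).
Proof. by move=> us; apply/tuple_uniqP. Qed.

Lemma finite_set_enumerates (T : Type) (D : set T) :
  finite_set D -> exists n, enumerates D n.
Proof.
move=> /(@finite_seqP {classic T})[s Ds].
exists (size (undup s)), (tnth (in_tuple (undup s))).
  exact/uniq_tnth_inj/undup_uniq.
move=> x; rewrite Ds /= -[x \in s](mem_undup s).
by split=> [/(tnthP (in_tuple _))//|xi]; apply/(tnthP (in_tuple (undup s))).
Qed.

Lemma infinite_set_inj (T : Type) (D : set T) n : ~ finite_set D ->
  exists2 h : 'I_n -> T, injective h & forall i, D (h i).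
Proof.
suff H (U : choiceType) (E : set U) : ~ finite_set E ->
    exists2 h : 'I_n -> U, injective h & forall i, E (h i).
  exact: (H {classic T}).
move=> /(@infinite_set_fset _ _ n)[X XE nX].
exists (fun i : 'I_n => tnth (in_tuple X) (widen_ord nX i)).
  move=> i j /(uniq_tnth_inj (fset_uniq X)) /(congr1 val) /= ij.
  exact: val_inj.
by move=> i; apply: XE; rewrite /= mem_tnth.
Qed.

Section PsumRank.
Context (k : fieldType) (disp : Order.disp_t) (T : porderType disp).
Context (I : Type) (A : I -> set T) (cvx : forall i, oconvex (A i)).

Let M := psum (fun i => kmod k (@cvx i)).

Lemma dsum_val_sum (V : I -> lmodType k) n (f : 'I_n -> dsum V) i :
  (\sum_l f l) i = \sum_l f l i.
Proof. exact: (big_morph (fun x : dsum V => x i)). Qed.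

(** The generator of the summand [i] at [s]; it is 0 when [s] is outside [A i], where the row vector
    has no entry. *)
Program Definition kmod_unit (s : T) (i : I) : M s :=
  @DSum k I (fun j => kmod k (@cvx j) s)
    (fun j => if `[< j = i >] then const_mx 1 else 0) _.
Next Obligation.
move=> s i; apply: (@sub_finite_set _ _ [set i]); last exact: finite_set1.
by move=> j /=; case: asboolP.
Qed.

Lemma mulmx_ones (a b : bool) : a ->
  (const_mx 1 : 'rV[k]_a) *m (const_mx 1 : 'M_(a, b)) = const_mx 1.
Proof.
by case: a => // _; apply/rowP => i; rewrite !mxE big_ord1 !mxE mulr1.
Qed.

Lemma mulmx_ones_out (a b : bool) (x : 'rV[k]_a) : ~~ (a && b) ->
  x *m (const_mx 1 : 'M_(a, b)) = 0.
Proof.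
case: a x => x /=; first by case: b => // _; apply/rowP => -[].
by move=> _; apply/rowP => i; rewrite !mxE big_ord0.
Qed.

(** The sum of the entries reads off the coordinate for length 0 and 1 alike. *)
Lemma scale_ones (b : bool) (v : 'rV[k]_b) :
  (\sum_j v 0 j) *: const_mx 1 = v.
Proof.
case: b v => v; last by apply/rowP => -[].
by apply/rowP => i; rewrite (ord1 i) big_ord1 !mxE mulr1.
Qed.

Lemma kmod_unit_map s t (st : (s <= t)%O) i : A i s ->
  pmor M st (kmod_unit s i) = kmod_unit t i.
Proof.
move=> Ais; apply: dsum_eq => j /=; case: asboolP => [->|_].
  by apply: mulmx_ones; apply: mem_set.
by rewrite mul0mx.
Qed.

Lemma kmod_unit_comb n (h : 'I_n -> I) t (c : 'I_n -> k) (m : 'I_n) :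
  injective h ->
  (\sum_l c l *: kmod_unit t (h l)) (h m) = c m *: const_mx 1.
Proof.
move=> h_inj; rewrite dsum_val_sum (bigD1 m) //= asboolT // big1 ?addr0 //.
by move=> l /eqP lm /=; case: asboolP => [/h_inj ?|_]; [case: lm|rewrite scaler0].
Qed.

Lemma kmod_unit_comb_out n (h : 'I_n -> I) t (c : 'I_n -> k) j :
  ~ (exists m, j = h m) ->
  (\sum_l c l *: kmod_unit t (h l)) j = 0.
Proof.
move=> jh; rewrite dsum_val_sum big1 // => l _ /=.
by case: asboolP => [jl|_]; [case: jh; exists l|rewrite scaler0].
Qed.

Lemma kmod_unit_free n (h : 'I_n -> I) t (c : 'I_n -> k) :
  injective h -> (forall l, A (h l) t) ->
  \sum_l c l *: kmod_unit t (h l) = 0 -> forall l, c l = 0.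
Proof.
move=> h_inj ht /(congr1 (fun f : M t => f (h _))) c0 l.
have := kmod_unit_comb t c l h_inj; rewrite c0 /= => /esym.
have : t \in A (h l) by apply: mem_set.
case: (t \in A (h l)) => // _.
by move=> /rowP/(_ 0); rewrite !mxE mulr1.
Qed.

(** The generators of the summands alive at both [s] and [t] form a basis of the image. *)
Lemma Rk_psum_kmod s t (st : (s <= t)%O) : finite_rank (pmor M st) ->
  enumerates [set i | A i s /\ A i t] (Rk M st).
Proof.
move=> [r rdim]; set D := [set i | _].
have Dfin : finite_set D.
  (* Otherwise the image, of dimension [r], contains [r.+1] independent generators. *)
  apply: contrapT => /(@infinite_set_inj _ _ r.+1)[h h_inj hD].
  move: rdim => /has_dimP[e [_ _ e_span]].
  have /choice[g gE] : forall l, exists u, kmod_unit t (h l) = lincomb e u.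
    move=> l; apply: e_span; exists (kmod_unit s (h l)) => //.
    by rewrite kmod_unit_map //; case: (hD l).
  suff /eqP : row_free (\matrix_l g l).
    by have := rank_leq_col (\matrix_l g l) => + E; rewrite E ltnn.
  apply: row_free_mul0 => u; rewrite mulmx_sum_row => uX.
  apply/rowP => l; rewrite mxE.
  apply: (@kmod_unit_free _ h t (u 0)) => //; first by move=> m; case: (hD m).
  under eq_bigr do rewrite gE -linearZ.
  rewrite -linear_sum /= (_ : \sum_i _ = 0) ?linear0 // -[RHS]uX.
  by apply: eq_bigr => i _; rewrite rowK.
have [n Dn] := finite_set_enumerates Dfin; suff -> : Rk M st = n by [].
case: Dn => h h_inj hD; have hD' l : D (h l) by apply/hD; exists l.
apply: has_dim_rank; exists (fun l => kmod_unit t (h l)); split.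
- move=> l; exists (kmod_unit s (h l)) => //.
  by rewrite kmod_unit_map //; case: (hD' l).
- by move=> c; apply: kmod_unit_free => // l; case: (hD' l).
- move=> _ [x _ <-].
  exists (fun l => \sum_j (pmor M st x : dsum _) (h l) 0 j).
  apply: dsum_eq => j; have [[l ->]|jh] := pselect (exists l, j = h l).
    by rewrite kmod_unit_comb // scale_ones.
  rewrite kmod_unit_comb_out //= mulmx_ones_out //; apply/negP.
  by move=> /andP[/set_mem js /set_mem jt]; apply/jh/hD.
Qed.

End PsumRank.

(** * Rank functions of interleaved modules *)

Section RankInterleaving.
Context (R : realType).

(* The case of interest is b = Rk M, c = Rk N and q s t = rank (M s -> N (t + delta))
   for M and N delta-interleaved; the fields ri_mono* and ri_*0 are the limit cases
   of the others where s' = -oo or t' = +oo. *)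
Record rank_interleaved (delta : R) (b c q : R -> R -> nat) : Prop := {
  ri_box : forall s' s t t', s' <= s -> s <= t -> t <= t' ->
    (q s' t + q s t' <= q s t + q s' t')%N;
  ri_monol : forall s' s t, s' <= s -> s <= t -> (q s' t <= q s t)%N;
  ri_monor : forall s t t', s <= t -> t <= t' -> (q s t' <= q s t)%N;
  ri_qb : forall s' s t, s' <= s -> s <= t ->
    (q s t + b s' t <= b s t + q s' t)%N;
  ri_qb0 : forall s t, s <= t -> (q s t <= b s t)%N;
  ri_bq : forall s' s t, s' <= s -> s <= t ->
    (b s (t + 2 * delta)%R + q s' t <= q s t + b s' (t + 2 * delta)%R)%N;
  ri_bq0 : forall s t, s <= t -> (b s (t + 2 * delta)%R <= q s t)%N;
  ri_qc : forall s t t', s <= t -> t <= t' ->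
    (q s t + c (s + delta)%R (t' + delta)%R <=
     c (s + delta)%R (t + delta)%R + q s t')%N;
  ri_qc0 : forall s t, s <= t -> (q s t <= c (s + delta)%R (t + delta)%R)%N;
  ri_cq : forall s t t', s <= t -> t <= t' ->
    (c (s - delta)%R (t + delta)%R + q s t' <=
     q s t + c (s - delta)%R (t' + delta)%R)%N;
  ri_cq0 : forall s t, s <= t -> (c (s - delta)%R (t + delta)%R <= q s t)%N }.

(** All conditions are additive, so summands can be added at the level of rank functions, without
    forming direct sums of modules. *)
Lemma rank_interleavedD delta b c q b' c' q' :
  rank_interleaved delta b c q -> rank_interleaved delta b' c' q' ->
  rank_interleaved delta (fun s t => b s t + b' s t)%N
    (fun s t => c s t + c' s t)%N (fun s t => q s t + q' s t)%N.
Proof.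
move=> [h1 h2 h3 h4 h5 h6 h7 h8 h9 h10 h11].
move=> [g1 g2 g3 g4 g5 g6 g7 g8 g9 g10 g11].
split.
- move=> s' s t t' s's st tt'.
  by have := h1 _ _ _ _ s's st tt'; have := g1 _ _ _ _ s's st tt'; lia.
- move=> s' s t s's st.
  by have := h2 _ _ _ s's st; have := g2 _ _ _ s's st; lia.
- move=> s' s t s's st.
  by have := h3 _ _ _ s's st; have := g3 _ _ _ s's st; lia.
- move=> s' s t s's st.
  by have := h4 _ _ _ s's st; have := g4 _ _ _ s's st; lia.
- by move=> s t st; have := h5 _ _ st; have := g5 _ _ st; lia.
- move=> s' s t s's st.
  by have := h6 _ _ _ s's st; have := g6 _ _ _ s's st; lia.
- by move=> s t st; have := h7 _ _ st; have := g7 _ _ st; lia.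
- move=> s' s t s's st.
  by have := h8 _ _ _ s's st; have := g8 _ _ _ s's st; lia.
- by move=> s t st; have := h9 _ _ st; have := g9 _ _ st; lia.
- move=> s' s t s's st.
  by have := h10 _ _ _ s's st; have := g10 _ _ _ s's st; lia.
- by move=> s t st; have := h11 _ _ st; have := g11 _ _ st; lia.
Qed.

Context (k : fieldType).
Implicit Types M N : persmod k R.

Definition total_rank M (s t : R) : nat :=
  if pselect (s <= t)%O is left st then Rk M st else 0.

Lemma total_rankE M (s t : R) (st : (s <= t)%O) : total_rank M s t = Rk M st.
Proof.
rewrite /total_rank; case: pselect => // st'.
by rewrite (Prop_irrelevance st' st).
Qed.

(** Having a map to every [N t] with [s + delta <= t], and not only to [N (s + delta)], avoids
    transport between points that are equal only by computation in [R]. *)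
Definition line_interleaved (delta : R) M N : Prop :=
  exists (f : forall s t, s + delta <= t -> {linear M s -> N t})
         (g : forall s t, s + delta <= t -> {linear N s -> M t}),
  [/\ forall s' s t (ss : (s' <= s)%O) h h' x,
        f s t h (pmor M ss x) = f s' t h' x,
      forall s t t' (tt : (t <= t')%O) h h' x,
        pmor N tt (f s t h x) = f s t' h' x,
      forall s t u h h' (su : (s <= u)%O) x, g t u h' (f s t h x) = pmor M su x
    & forall s t u h h' (su : (s <= u)%O) x, f t u h' (g s t h x) = pmor N su x].

Lemma line_interleaved_refl delta M : 0 <= delta -> line_interleaved delta M M.
Proof.
move=> d0; have le s t : s + delta <= t -> (s <= t)%O by move=> ?; lra.
exists (fun s t h => pmor M (le s t h)), (fun s t h => pmor M (le s t h)).
by split=> *; apply/esym/pmor_comp.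
Qed.

(** Each field is the Frobenius inequality for a chain of three maps, or, in the limit cases,
    monotonicity of the rank under composition. *)
Lemma line_interleaved_rank delta M N : 0 <= delta -> pfd M -> pfd N ->
  line_interleaved delta M N ->
  exists q, rank_interleaved delta (total_rank M) (total_rank N) q.
Proof.
move=> d0 fM fN [f [g [fpre fpost gf fg]]].
pose q s t := if pselect (s + delta <= t + delta) is left h
  then rank (f s (t + delta) h) else 0%N.
have qE s t h : q s t = rank (f s (t + delta) h).
  rewrite /q; case: pselect => // h'.
  by rewrite (Prop_irrelevance h' h).
have H s t : s <= t -> s + delta <= t + delta by rewrite lerD2r.
exists q; split.
(* Chain [M s' -> M s -> N (t + delta) -> N (t' + delta)]. *)
- move=> s' s t t' s's st tt'; have tt2 : (t + delta <= t' + delta)%O by exact: H.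
  rewrite (qE _ _ (H _ _ (le_trans s's st))) (qE _ _ (H _ _ (le_trans st tt'))).
  rewrite (qE _ _ (H _ _ st)) (qE _ _ (H _ _ (le_trans s's (le_trans st tt')))).
  apply: (@rank_Frobenius _ _ _ _ _ (pmor M s's) _ (pmor N tt2)) => // x;
    first [
    by rewrite (fpre _ _ _ _ _ (H _ _ (le_trans s's st)))
    | by rewrite (fpost _ _ _ _ _ (H _ _ (le_trans st tt')))
    | rewrite (fpost _ _ _ _ _ (H _ _ (le_trans st tt')));
      by rewrite (fpre _ _ _ _ _ (H _ _ (le_trans s's (le_trans st tt'))))].
- move=> s' s t s's st.
  rewrite (qE _ _ (H _ _ (le_trans s's st))) (qE _ _ (H _ _ st)).
  apply: (@rank_comp_ler _ _ _ _ (pmor M s's)) => //.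
- move=> s t t' st tt'.
  rewrite (qE _ _ (H _ _ (le_trans st tt'))) (qE _ _ (H _ _ st)).
  apply: (@rank_comp_lel _ _ _ _ _ (pmor N (H _ _ tt'))) => //.
(* Chain [M s' -> M s -> M t -> N (t + delta)]. *)
- move=> s' s t s's st; have s't := le_trans s's st.
  rewrite (qE _ _ (H _ _ st)) (qE _ _ (H _ _ s't)).
  rewrite (total_rankE M st) (total_rankE M s't).
  rewrite addnC.
  apply: (@rank_Frobenius _ _ _ _ _ (pmor M s's) _ (f t _ (H _ _ (lexx t)))) => // x;
    first [
    exact: pmor_comp
    | by rewrite (fpre _ _ _ _ _ (H _ _ st))
    | by rewrite -(pmor_comp _ _ s't) (fpre _ _ _ _ _ (H _ _ s't))].
- move=> s t st; rewrite (qE _ _ (H _ _ st)) (total_rankE M st).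
  apply: (@rank_comp_lel _ _ _ _ _ (f t _ (H _ _ (lexx t)))) => //.
(* Chain [M s' -> M s -> N (t + delta) -> M (t + 2 * delta)]. *)
- move=> s' s t s's st; have s't := le_trans s's st.
  have h2 : (t + delta) + delta <= t + 2 * delta by lra.
  have st2 : (s <= t + 2 * delta)%O by lra.
  have s't2 : (s' <= t + 2 * delta)%O by lra.
  rewrite (qE _ _ (H _ _ st)) (qE _ _ (H _ _ s't)).
  rewrite (total_rankE M st2) (total_rankE M s't2).
  rewrite addnC.
  apply: (@rank_Frobenius _ _ _ _ _ (pmor M s's) _ (g _ _ h2)) => // x;
    first [
    by rewrite (fpre _ _ _ _ _ (H _ _ s't))
    | by rewrite (gf _ _ _ _ _ st2)
    | by rewrite (gf _ _ _ _ _ st2) -(pmor_comp _ _ s't2)].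
- move=> s t st; have h2 : (t + delta) + delta <= t + 2 * delta by lra.
  have st2 : (s <= t + 2 * delta)%O by lra.
  rewrite (qE _ _ (H _ _ st)) (total_rankE M st2).
  apply: (@rank_comp_lel _ _ _ _ _ (g _ _ h2)) => //.
(* Chain [M s -> N (s + delta) -> N (t + delta) -> N (t' + delta)]. *)
- move=> s t t' st tt'; have st' := le_trans st tt'.
  rewrite (qE _ _ (H _ _ st)) (qE _ _ (H _ _ st')).
  rewrite (total_rankE N (H _ _ st)) (total_rankE N (H _ _ st')).
  apply: (@rank_Frobenius _ _ _ _ _ (f s _ (H _ _ (lexx s))) _
    (pmor N (H _ _ tt'))) => // x;
    first [
    by rewrite (fpost _ _ _ _ _ (H _ _ st))
    | exact: pmor_comp
    | by rewrite -(pmor_comp _ _ (H _ _ tt')) (fpost _ _ _ _ _ (H _ _ st'))].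
- move=> s t st; rewrite (qE _ _ (H _ _ st)) (total_rankE N (H _ _ st)).
  apply: (@rank_comp_ler _ _ _ _ (f s _ (H _ _ (lexx s)))) => //.
(* Chain [N (s - delta) -> M s -> N (t + delta) -> N (t' + delta)]. *)
- move=> s t t' st tt'; have st' := le_trans st tt'.
  have h2 : s - delta + delta <= s by lra.
  have st2 : (s - delta <= t + delta)%O by lra.
  have st2' : (s - delta <= t' + delta)%O by lra.
  rewrite (qE _ _ (H _ _ st)) (qE _ _ (H _ _ st')).
  rewrite (total_rankE N st2) (total_rankE N st2').
  apply: (@rank_Frobenius _ _ _ _ _ (g _ _ h2) _ (pmor N (H _ _ tt'))) => // x;
    first [
    by rewrite (fg _ _ _ _ _ st2)
    | by rewrite (fpost _ _ _ _ _ (H _ _ st'))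
    | by rewrite (fg _ _ _ _ _ st2) -(pmor_comp _ _ st2')].
- move=> s t st; have h2 : s - delta + delta <= s by lra.
  have st2 : (s - delta <= t + delta)%O by lra.
  rewrite (qE _ _ (H _ _ st)) (total_rankE N st2).
  apply: (@rank_comp_ler _ _ _ _ (g _ _ h2)) => //.
Qed.

End RankInterleaving.

(** * Bars seen by a grid *)

Lemma enumerates_finite (T : Type) (D : set T) n : enumerates D n -> finite_set D.
Proof.
move=> [h _ hD]; apply: (@sub_finite_set _ _ (h @` [set: 'I_n])).
  by move=> x /hD[i ->]; exists i.
exact/finite_image/finite_finset.
Qed.

Lemma enumerates_card (T : Type) (D : set T) m N (h : 'I_N -> T) :
  enumerates D m -> injective h -> (forall x, D x -> exists p, x = h p) ->
  #|[pred p | `[< D (h p) >]]| = m.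
Proof.
move=> [g g_inj gD] h_inj hD.
have /choice[f fE] l : exists p, g l = h p by apply: hD; apply/gD; exists l.
have f_inj : injective f by move=> l l' ff; apply: g_inj; rewrite !fE ff.
rewrite -[RHS]card_ord -(fintype.card_image f_inj); apply: eq_card => p; rewrite inE.
apply/asboolP/fintype.imageP => [/gD[l hl]|[l _ ->]].
  by exists l => //; apply: h_inj; rewrite hl fE.
by apply/gD; exists l; rewrite fE.
Qed.

Section Bars.
Context (R : realType).
Implicit Types (J : nitv R).

Lemma birth_le J (x : R) : x \in nitv_val J -> (itv_birth J <= x%:E)%E.
Proof.
case: J => -[a b] /= _; rewrite itv_boundlr /itv_birth /= => /andP[ax _].
by case: a ax => [[] a|[]] //=; rewrite ?bnd_simp ?lee_fin ?leNye // => /ltW.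
Qed.

Lemma death_ge J (x : R) : x \in nitv_val J -> (x%:E <= itv_death J)%E.
Proof.
case: J => -[a b] /= _; rewrite itv_boundlr /itv_death /= => /andP[_ xb].
by case: b xb => [[] b|[]] //=; rewrite ?bnd_simp ?lee_fin ?leey // => /ltW.
Qed.

Lemma mem_nitv J (x : R) :
  (itv_birth J < x%:E)%E -> (x%:E < itv_death J)%E -> x \in nitv_val J.
Proof.
case: J => -[a b] /= _; rewrite itv_boundlr /itv_birth /itv_death /= => ax xb.
apply/andP; split.
  by case: a ax => [[] a|[]] //=; rewrite lte_fin bnd_simp // => /ltW.
by case: b xb => [[] b|[]] //=; rewrite lte_fin bnd_simp // => /ltW.
Qed.

Lemma notin_birth J (x y : R) :
  y \in nitv_val J -> x < y -> x \notin nitv_val J -> (x%:E <= itv_birth J)%E.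
Proof.
move=> yJ xy; apply: contraR; rewrite -ltNge => xJ; apply: mem_nitv => //.
by apply: lt_le_trans (death_ge yJ); rewrite lte_fin.
Qed.

Lemma notin_death J (x y : R) :
  y \in nitv_val J -> y < x -> x \notin nitv_val J -> (itv_death J <= x%:E)%E.
Proof.
move=> yJ yx; apply: contraR; rewrite -ltNge => xJ; apply: mem_nitv => //.
by apply: le_lt_trans (birth_le yJ) _; rewrite lte_fin.
Qed.

Lemma mem_nitv_between J (x y z : R) : x <= y -> y <= z ->
  x \in nitv_val J -> z \in nitv_val J -> y \in nitv_val J.
Proof. exact: (@nitv_oconvex R J). Qed.

Definition bar_counts (B : multiset (nitv R)) (b : R -> R -> nat) : Prop :=
  forall s t, s <= t ->
  enumerates [set i : midx B | s \in nitv_val (B i) /\ t \in nitv_val (B i)]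
    (b s t).

(** A bar that misses all [n] grid points has no label. *)
Definition grid_label (gam : nat -> R) (n : nat) J (i j : nat) : Prop :=
  [/\ (0 < i)%N, (i <= j)%N, (j <= n)%N & forall m, (0 < m <= n)%N ->
      (gam m \in nitv_val J) = (i <= m <= j)%N].

Lemma grid_label_ex gam n J m : {homo gam : i j / (i <= j)%N >-> i <= j} ->
  (0 < m <= n)%N -> gam m \in nitv_val J -> exists i j, grid_label gam n J i j.
Proof.
move=> gam_mono mn mJ; pose S i := (0 < i <= n)%N && (gam i \in nitv_val J).
have exS : exists i, S i by exists m; rewrite /S mn.
have ubS i : S i -> (i <= n)%N by case/andP => /andP[].
case: (ex_minnP exS) => i Si i_min; case: (ex_maxnP exS ubS) => j Sj j_max.
exists i, j; case/andP: (Si) => /andP[i0 iN] iJ; case/andP: (Sj) => /andP[j0 jn] jJ.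
split=> //; first exact: i_min.
move=> l ln; apply/idP/idP => [lJ|/andP[il lj]].
  by have Sl : S l by [rewrite /S ln]; rewrite i_min // j_max.
exact: mem_nitv_between (gam_mono _ _ il) (gam_mono _ _ lj) iJ jJ.
Qed.

Lemma grid_label_mem gam n J i j : grid_label gam n J i j ->
  gam i \in nitv_val J /\ gam j \in nitv_val J.
Proof. by move=> [i0 ij jn E]; rewrite !E; lia. Qed.

Lemma grid_label_uniq gam n J i j i' j' :
  grid_label gam n J i j -> grid_label gam n J i' j' -> i = i' /\ j = j'.
Proof.
move=> [i0 ij jn E] [i'0 ij' j'n E'].
suff F k : (0 < k <= n)%N -> (i <= k <= j)%N = (i' <= k <= j')%N.
  have Fi := F i; have Fj := F j; have Fi' := F i'; have Fj' := F j'.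
  by clear E E' F; lia.
by move=> kn; rewrite -E // E'.
Qed.

Definition grid (g0 eta : R) (m : nat) : R := g0 + m%:R * eta.

(** The bars of [N] are sampled here because the intermediate module is the image of [M] in the
    shift of [N] by [delta]. *)
Definition shifted_grid (g0 eta delta : R) (m : nat) : R := grid g0 eta m + delta.

Section Grid.
Variables (B C : multiset (nitv R)) (b c q : R -> R -> nat).
Variables (delta g0 eta : R) (L n : nat).
Hypothesis eta_gt0 : 0 < eta.
Hypothesis L_eta : L%:R * eta = 2 * delta.
Hypothesis ri : rank_interleaved delta b c q.
Hypothesis B_b : bar_counts B b.
Hypothesis C_c : bar_counts C c.

Local Notation g := (grid g0 eta).
Local Notation g' := (shifted_grid g0 eta delta).

Lemma grid_le : {homo g : i j / (i <= j)%N >-> i <= j}.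
Proof. by move=> i j ij; rewrite lerD2l ler_pM2r // ler_nat. Qed.

Lemma shifted_grid_le : {homo g' : i j / (i <= j)%N >-> i <= j}.
Proof. by move=> i j ij; rewrite lerD2r grid_le. Qed.

Lemma grid_lt : {mono g : i j / (i < j)%N >-> i < j}.
Proof. by move=> i j; rewrite ltrD2l ltr_pM2r // ltr_nat. Qed.

Lemma gridL i : g (i + L) = g i + 2 * delta.
Proof. by rewrite /grid natrD mulrDl L_eta addrA. Qed.

Lemma gridS i : g i.+1 = g i + eta.
Proof. by rewrite /grid -natr1 mulrDl mul1r addrA. Qed.

(** Each of the finitely many grid points lies in finitely many bars, so the bars with a label form
    a finite family, and counting labels recovers [r]. *)
Lemma grid_bars (D : multiset (nitv R)) (r : R -> R -> nat) (gam : nat -> R) :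
  bar_counts D r -> {homo gam : i j / (i <= j)%N >-> i <= j} ->
  exists N (h : 'I_N -> midx D) (fi la : 'I_N -> nat),
  [/\ injective h, forall p, grid_label gam n (D (h p)) (fi p) (la p),
      forall (x : midx D) i j, grid_label gam n (D x) i j ->
        exists p, [/\ x = h p, fi p = i & la p = j]
    & forall i j, (0 < i <= j)%N -> (j <= n)%N ->
      #|[pred p | (fi p <= i)%N && (j <= la p)%N]| = r (gam i) (gam j)].
Proof.
move=> Dr gam_mono.
pose A := \bigcup_(m in `I_n) [set x : midx D | gam m.+1 \in nitv_val (D x)].
have [N [h h_inj hA]] : exists N, enumerates A N.
  apply/finite_set_enumerates/bigcup_finite => [|m mn]; first exact: finite_II.
  apply: sub_finite_set (enumerates_finite (Dr _ _ (lexx (gam m.+1)))).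
  by move=> x /= xm.
have hlab p : exists ij : nat * nat, grid_label gam n (D (h p)) ij.1 ij.2.
  have [m /= mn mD] : A (h p) by apply/hA; exists p.
  by have [|i [j ij]] := @grid_label_ex gam n (D (h p)) m.+1 gam_mono _ mD;
    [rewrite ltn0Sn|exists (i, j)].
have /choice[f fE] := hlab.
have fA x i j : grid_label gam n (D x) i j -> A x.
  move=> lx; have [xi _] := grid_label_mem lx; case: lx => i0 ij jn _.
  exists i.-1; last by rewrite /= prednK.
  by rewrite /=; lia.
exists N, h, (fun p => (f p).1), (fun p => (f p).2); split => //.
  move=> x i j lx; have /hA[p xp] := fA _ _ _ lx; exists p; split => //.
    by rewrite xp in lx; case: (grid_label_uniq lx (fE p)).
  by rewrite xp in lx; case: (grid_label_uniq lx (fE p)).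
move=> i j ij jn; have gij : gam i <= gam j by apply: gam_mono; case/andP: ij.
rewrite -(enumerates_card (Dr _ _ gij) h_inj); last first.
  move=> x [xi _]; apply/hA; exists i.-1; last by rewrite /= prednK //; case/andP: ij.
  by rewrite /=; lia.
apply: eq_card => p; rewrite !inE; case: (fE p) => f0 f12 fn E.
have Ei := E i; have Ej := E j.
have {}Ei : (gam i \in nitv_val (D (h p))) = ((f p).1 <= i <= (f p).2)%N.
  by apply: Ei; lia.
have {}Ej : (gam j \in nitv_val (D (h p))) = ((f p).1 <= j <= (f p).2)%N.
  by apply: Ej; lia.
apply/idP/asboolP => /= [?|[]]; rewrite Ei Ej; last by clear E; lia.
by clear E; split; lia.
Qed.

Lemma grid_bar_matching : exists sigma : midx B -> midx C -> Prop,
  [/\ partial_bij sigma,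
      forall (x : midx B) (y : midx C), sigma x y -> exists i j i' j',
        [/\ grid_label g n (B x) i j, grid_label g' n (C y) i' j',
            (i' <= i <= i' + L)%N & (j' <= j <= j' + L)%N],
      forall (x : midx B) i j, grid_label g n (B x) i j -> (i + L <= j)%N ->
        exists y, sigma x y
    & forall (y : midx C) i j, grid_label g' n (C y) i j -> (i + L <= j)%N ->
        exists x, sigma x y].
Proof.
have [N [h [fi [la [h_inj lab lab_ex cardE]]]]] := grid_bars B_b grid_le.
have [N' [h' [fi' [la' [h'_inj lab' lab'_ex cardE']]]]] :=
  grid_bars C_c shifted_grid_le.
(* The value is 0 at the indices that stand for -oo and +oo; inequalities that involve them come
   from the limit fields of [ri]. *)
pose qq i j := if (0 < i)%N && (j <= n)%N then q (g i) (g j) else 0%N.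
have qqE i j : (0 < i)%N -> (j <= n)%N -> qq i j = q (g i) (g j).
  by rewrite /qq => -> ->.
have qqn i j : (n < j)%N -> qq i j = 0%N by rewrite /qq => nj; case: ifP => //; lia.
have card0 j : #|[pred p | (fi p <= 0)%N && (j <= la p)%N]| = 0%N.
  by apply: eq_card0 => p; rewrite !inE; case: (lab p) => ?; lia.
have card0' j : #|[pred p | (fi' p <= 0)%N && (j <= la' p)%N]| = 0%N.
  by apply: eq_card0 => p; rewrite !inE; case: (lab' p) => ?; lia.
have cardn i j : (n < j)%N -> #|[pred p | (fi p <= i)%N && (j <= la p)%N]| = 0%N.
  by move=> nj; apply: eq_card0 => p; rewrite !inE; case: (lab p) => ?; lia.
have cardn' i j : (n < j)%N -> #|[pred p | (fi' p <= i)%N && (j <= la' p)%N]| = 0%N.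
  by move=> nj; apply: eq_card0 => p; rewrite !inE; case: (lab' p) => ?; lia.
have [] := @grid_matching _ _ fi la fi' la' n L qq.
- by move=> p; case: (lab p) => *; split; lia.
- by move=> p; case: (lab' p) => *; split; lia.
- by [].
- by move=> i; rewrite qqn.
- move=> [//|i] j /= ij jn; have gij : g i.+1 <= g j by exact: grid_le.
  have gi : g i <= g i.+1 by exact: grid_le.
  have gj : g j <= g j.+1 by exact: grid_le.
  have [jn'|jn'] := ltnP j n.
    case: i ij gij gi => [|i] ij gij gi; rewrite ![qq _.+1 _]qqE //.
      by rewrite /qq /= add0n addn0; exact: (ri_monor ri).
    exact: (ri_box ri).
  rewrite ![qq _ j.+1]qqn ?addn0 //.
  case: i ij gij gi => [|i] ij gij gi; rewrite ![qq _.+1 _]qqE //.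
  exact: (ri_monol ri).
- move=> [//|i] j /= ij jn; have gij : g i.+1 <= g j by exact: grid_le.
  have gi : g i <= g i.+1 by exact: grid_le.
  rewrite (cardE i.+1) //; case: i ij gij gi => [|i] ij gij gi.
    by rewrite card0 qqE // /qq /= !addn0; exact: (ri_qb0 ri).
  by rewrite !qqE // cardE //=; [exact: (ri_qb ri)|lia].
- move=> [//|i] j /= ij jn; have gij : g i.+1 <= g j by exact: grid_le.
  have gi : g i <= g i.+1 by exact: grid_le.
  have [jL|jL] := leqP (j + L) n.
    rewrite (cardE i.+1) //; last by lia.
    case: i ij gij gi => [|i] ij gij gi.
      by rewrite card0 (qqE 1%N) // /qq /= !addn0 gridL; exact: (ri_bq0 ri).
    by rewrite !qqE // cardE //= ?gridL; [exact: (ri_bq ri)|lia].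
  rewrite !cardn // addn0 add0n.
  case: i ij gij gi => [|i] ij gij gi //.
  by rewrite !qqE //; exact: (ri_monol ri).
- move=> [//|i] j /= ij jn; have gij : g i.+1 <= g j by exact: grid_le.
  have gj : g j <= g j.+1 by exact: grid_le.
  rewrite (cardE' _ j) // qqE //; have [jn'|jn'] := ltnP j n.
    by rewrite cardE' ?qqE //; [exact: (ri_qc ri)|lia].
  by rewrite cardn' // qqn // !addn0; exact: (ri_qc0 ri).
- move=> [//|i] j /= ij jn; have gij : g i.+1 <= g j by exact: grid_le.
  have gj : g j <= g j.+1 by exact: grid_le.
  (* Here truncated subtraction gives index 0, where no bar is counted, and monotonicity of [q]
     remains. *)
  have [iL|iL] := leqP i.+1 L.
    have -> : (i.+1 - L)%N = 0%N by lia.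
    rewrite !card0' add0n addn0.
    have [jn'|jn'] := ltnP j n; last by rewrite qqn.
    by rewrite !qqE //; exact: (ri_monor ri).
  (* [L] steps back are [2 * delta], and the shifted grid gives [delta] back. *)
  have giL : g' (i.+1 - L) = g i.+1 - delta.
    have := gridL (i.+1 - L)%N; rewrite subnK /shifted_grid; last exact: ltnW.
    by move=> ->; lra.
  rewrite (cardE' _ j) //; last by lia.
  rewrite giL (qqE _ j) //; have [jn'|jn'] := ltnP j n.
    by rewrite cardE' ?qqE ?giL //; [exact: (ri_cq ri)|lia].
  by rewrite cardn' // qqn // !addn0; exact: (ri_cq0 ri).
move=> sigma [sigma_bij sigmaE sigma_p sigma_p'].
exists (fun x y => exists p p', [/\ x = h p, y = h' p' & sigma p p']).
split; first split.
- move=> x y y' [p [p1 [-> -> s1]]] [p' [p1' [/h_inj pp -> s2]]].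
  by rewrite -pp in s2; congr h'; apply: sigma_bij.1 s1 s2.
- move=> x x' y [p [p1 [-> -> s1]]] [p' [p1' [-> /h'_inj pp s2]]].
  by rewrite -pp in s2; congr h; apply: sigma_bij.2 s1 s2.
- move=> x y [p [p' [-> -> /sigmaE[fip lap]]]].
  by exists (fi p), (la p), (fi' p'), (la' p').
- move=> x i j /lab_ex[p [-> <- <-]] /sigma_p[p' pp'].
  by exists (h' p'), p, p'.
- move=> y i j /lab'_ex[p' [-> <- <-]] /sigma_p'[p pp'].
  by exists (h p), p, p'.
Qed.

End Grid.
End Bars.

(** * From grid labels to bar endpoints *)

Section Deep.
Context (R : realType).
Implicit Types (J : nitv R) (p r : R).

(** A deep point anchors its bar: the partners of the bar will be sought among the finitely many
    bars that contain the point. *)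
Definition deep r J p : Prop :=
  (itv_birth J + r%:E < p%:E)%E /\ (p%:E + r%:E < itv_death J)%E.

Lemma deep_ex r J : 0 <= r ->
  ~ (itv_death J <= itv_birth J + (2 * r)%:E)%E -> exists p, deep r J p.
Proof.
move=> r0 /negP; rewrite -ltNge /deep.
case: (itv_birth J) (itv_death J) => [x||] [y||] //=; rewrite ?lte_fin.
- by move=> xy; exists ((x + y) / 2); rewrite -!EFinD !lte_fin; split; lra.
- by move=> _; exists (x + r + 1); rewrite -!EFinD !lte_fin ltey; split => //; lra.
- by move=> _; exists (y - r - 1); rewrite -!EFinD !lte_fin ltNye; split => //; lra.
- by move=> _; exists 0; rewrite ltNye ltey.
Qed.

Lemma deep_mem r J p : 0 <= r -> deep r J p -> p \in nitv_val J.
Proof.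
move=> r0 [bp pd]; apply: mem_nitv.
  by apply: le_lt_trans bp; rewrite leeDl // lee_fin.
by apply: le_lt_trans pd; rewrite leeDl // lee_fin.
Qed.

Section Label.
Variables (gam : nat -> R) (eta : R) (n : nat).
Hypothesis eta_gt0 : 0 < eta.
Hypothesis gamS : forall m, gam m.+1 = gam m + eta.

(** Either the label is 1, or the preceding grid point is outside the bar and the birth is at most
    [eta] below [gam i]. *)
Lemma label_birth_lt J i j r p : grid_label gam n J i j ->
  (itv_birth J + (r + eta)%:E < p%:E)%E -> gam 1%N + r < p -> gam i + r < p.
Proof.
move=> lab bp p1; have [iJ _] := grid_label_mem lab; case: lab => i0 ij jn E.
case: i i0 ij iJ E => // -[//|i] _ ij iJ E.
have iNJ : gam i.+1 \notin nitv_val J by rewrite E; lia.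
have := notin_birth iJ _ iNJ; rewrite (gamS i.+1) ltrDl => /(_ eta_gt0) ib.
rewrite -lte_fin; apply: le_lt_trans bp.
rewrite -addrA addrA -addrA [eta + r]addrC EFinD.
by rewrite leeD2r.
Qed.

Lemma label_death_gt J i j r p : grid_label gam n J i j ->
  (p%:E + (r + eta)%:E < itv_death J)%E -> p + r < gam n -> p + r < gam j.
Proof.
move=> lab pd pn; have [_ jJ] := grid_label_mem lab; case: lab => i0 ij jn E.
move: jn; rewrite leq_eqVlt => /orP[/eqP -> //|jn].
have jNJ : gam j.+1 \notin nitv_val J by rewrite E; lia.
have := notin_death jJ _ jNJ; rewrite gamS ltrDl => /(_ eta_gt0) jd.
have := lt_le_trans pd jd; rewrite -EFinD lte_fin; lra.
Qed.

(** The last grid point up to [p] is less than [eta] away from [p], hence in the bar. *)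
Lemma deep_label_ex J r p : eta <= r -> deep r J p -> gam 1%N < p -> p < gam n ->
  exists i j, grid_label gam n J i j.
Proof.
move=> er [bp pd] p1 pn.
have gam_le : {homo gam : i j / (i <= j)%N >-> i <= j}.
  by apply: homo_leq => [//|x y z|m]; [exact: le_trans|rewrite gamS lerDl ltW].
have exm : exists m, p < gam m by exists n.
case: (ex_minnP exm) => m pm m_min.
have m1 : (1 < m)%N.
  by rewrite ltnNge; apply/negP => /gam_le m1; lra.
have mn : (m <= n)%N by exact: m_min.
case: m m1 mn pm m_min => // m m1 mn; rewrite gamS => pm m_min.
have mp : gam m <= p by rewrite leNgt; apply/negP => /m_min; rewrite ltnn.
apply: (@grid_label_ex _ _ _ _ m) => //; first by lia.
apply: mem_nitv.
  have := lt_trans bp (_ : p%:E < (gam m + r)%:E)%E.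
  rewrite lte_fin => /(_ ltac:(lra)); rewrite EFinD lteD2rE //.
apply: le_lt_trans pd; rewrite -EFinD lee_fin; lra.
Qed.

End Label.

Section Close.
Variables (I J : nitv R) (delta g0 eta lo hi : R) (L n i j i' j' : nat).
Hypothesis delta_ge0 : 0 <= delta.
Hypothesis eta_gt0 : 0 < eta.
Hypothesis L_eta : L%:R * eta = 2 * delta.
Hypothesis labI : grid_label (grid g0 eta) n I i j.
Hypothesis labJ : grid_label (shifted_grid g0 eta delta) n J i' j'.
Hypothesis ii' : (i' <= i <= i' + L)%N.
Hypothesis jj' : (j' <= j <= j' + L)%N.
Hypothesis lo_g0 : g0 + 4 * delta + 4 * eta < lo.
Hypothesis hi_gn : hi + 4 * delta + 4 * eta < grid g0 eta n.

Let g := grid g0 eta.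
Let gS m : g m.+1 = g m + eta. Proof. exact: gridS. Qed.
Let gL m : g (m + L) = g m + 2 * delta. Proof. exact: gridL. Qed.
Let g_le : {homo g : i j / (i <= j)%N >-> i <= j}. Proof. exact: grid_le. Qed.
Let g_lt : {mono g : i j / (i < j)%N >-> i < j}. Proof. exact: grid_lt. Qed.
Let g_0 : g 0%N = g0. Proof. by rewrite /g /grid mul0r addr0. Qed.

Hypothesis birthI : forall r, itv_birth I = r%:E -> lo <= r.
Hypothesis birthJ : forall r, itv_birth J = r%:E -> lo <= r.
Hypothesis deathI : forall r, itv_death I = r%:E -> r <= hi.
Hypothesis deathJ : forall r, itv_death J = r%:E -> r <= hi.

(** Each finite birth is within one step below its label. The labels differ by 0 to [2 * delta], and
    the shift of the second grid centres this error to at most [delta] in absolute value. *)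
Lemma label_eclose_birth : eclose (delta + eta) (itv_birth I) (itv_birth J).
Proof.
have [iI _] := grid_label_mem labI; have [iJ _] := grid_label_mem labJ.
case: labI => i0 ij jn E; case: labJ => i'0 ij' j'n E'.
have bI := birth_le iI; have bJ := birth_le iJ; rewrite -/g in iI bI.
rewrite /shifted_grid -/g in iJ bJ.
have d0 : 0 <= delta by [].
have e0 : 0 < eta by [].
have g1 : g 1%N = g0 + eta by rewrite gS g_0.
have lo0 : g0 + 4 * delta + 4 * eta < lo by [].
have gii' : g i <= g i' + 2 * delta by rewrite -gL g_le //; case/andP: ii'.
have gi'i : g i' <= g i by rewrite g_le //; case/andP: ii'.
case eI : (itv_birth I) => [r||]; last 2 first.
- by rewrite eI in bI.
(* A birth at -oo forces both labels to be 1; a finite birth of [J] would then lie below [lo]. *)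
- have i1 : i = 1%N.
    have : g 1%N \in nitv_val I.
      have [i1|i1] := leqP i 1.
        by rewrite (_ : 1%N = i) //; apply/eqP; rewrite eqn_leq i0.
      apply: contrapT => /negP N1.
      by have := notin_birth iI _ N1; rewrite g_lt i1 => /(_ isT); rewrite eI leeNy_eq.
    rewrite E; last by rewrite /= (leq_trans i0 (leq_trans ij jn)).
    by case/andP => i1 _; apply/eqP; rewrite eqn_leq i1.
  have i'1 : i' = 1%N.
    by apply/eqP; rewrite eqn_leq i'0 andbT -i1; case/andP: ii'.
  case eJ : (itv_birth J) => [r||] //.
    exfalso; have lor := birthJ eJ; rewrite eJ i'1 g1 lee_fin in bJ.
    suff: r < r by rewrite ltxx.
    lra.
  by rewrite eJ in bJ.
(* A finite birth is at least [lo], so [i] exceeds [L.+1] and [i'] exceeds 1: both labels have a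
   predecessor on the grid, outside the bar. *)
have lor := birthI eI; rewrite eI lee_fin in bI.
have Li : (L.+1 < i)%N.
  by rewrite -g_lt (gL 1%N : g L.+1 = _) g1; lra.
case: i' i'0 ij' E' iJ bJ gii' gi'i ii' => // -[|m] _ ij' E' iJ bJ gii' gi'i im.
  by exfalso; clear -im Li; lia.
have mN : g m.+1 + delta \notin nitv_val J.
  by have := E' m.+1; rewrite /shifted_grid -/g => ->; clear -ij' j'n; lia.
have := notin_birth iJ _ mN; rewrite ltrD2r g_lt ltnSn => /(_ isT).
case eJ : (itv_birth J) bJ => [r'||] //; rewrite !lee_fin => bJ bJ'.
have iN : g i.-1 \notin nitv_val I.
  by rewrite E; clear -i0 ij jn Li; lia.
have := notin_birth iI _ iN; rewrite g_lt => /(_ ltac:(clear -i0; lia)).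
rewrite eI lee_fin => bI'.
have gi1 : g i = g i.-1 + eta by rewrite -gS prednK.
have := gS m.+1.
by rewrite /eclose -!EFinD !lee_fin; split; lra.
Qed.

(** Mirror argument at the last grid point, with [hi] in place of [lo]. *)
Lemma label_eclose_death : eclose (delta + eta) (itv_death I) (itv_death J).
Proof.
have [_ jI] := grid_label_mem labI; have [_ jJ] := grid_label_mem labJ.
case: labI => i0 ij jn E; case: labJ => i'0 ij' j'n E'.
have dI := death_ge jI; have dJ := death_ge jJ; rewrite -/g in jI dI.
rewrite /shifted_grid -/g in jJ dJ.
have d0 : 0 <= delta by [].
have e0 : 0 < eta by [].
have gjj' : g j <= g j' + 2 * delta by rewrite -gL g_le //; case/andP: jj'.
have gj'j : g j' <= g j by rewrite g_le //; case/andP: jj'.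
have hgn : hi + 4 * delta + 4 * eta < g n by [].
case eI : (itv_death I) => [r||]; last 2 first.
- have jn' : j = n.
    move: jn; rewrite leq_eqVlt => /orP[/eqP //|jn'].
    have jN : g j.+1 \notin nitv_val I by rewrite E; clear -jn'; lia.
    by have := notin_death jI _ jN; rewrite g_lt ltnSn eI => /(_ isT).
  case eJ : (itv_death J) => [r||] //.
    exfalso; have hir := deathJ eJ; rewrite eJ lee_fin in dJ; rewrite -jn' in hgn.
    suff: r < r by rewrite ltxx.
    lra.
  by rewrite eJ in dJ.
- by rewrite eI in dI.
have hir := deathI eI; rewrite eI lee_fin in dI.
have jn' : (j < n)%N by rewrite -g_lt; lra.
have jN : g j.+1 \notin nitv_val I by rewrite E; clear -jn'; lia.
have := notin_death jI _ jN; rewrite g_lt ltnSn eI lee_fin => /(_ isT) dI'.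
have j'N : g j'.+1 + delta \notin nitv_val J.
  by have := E' j'.+1; rewrite /shifted_grid -/g => ->; clear -jj' jn'; lia.
have := notin_death jJ _ j'N; rewrite ltrD2r g_lt ltnSn => /(_ isT).
case eJ : (itv_death J) dJ => [r'||] //; rewrite !lee_fin => dJ dJ'.
have := gS j; have := gS j'.
by rewrite /eclose -!EFinD !lee_fin; split; lra.
Qed.

End Close.
End Deep.

(** * Stability of bars counting ranks *)

Lemma finite_set_bounded (R : realType) (V : set R) : finite_set V ->
  exists2 Z, 0 <= Z & forall v, V v -> - Z <= v <= Z.
Proof.
move=> /finite_seqP[s ->]; elim: s => [|a s [Z Z0 sZ]]; first by exists 0.
exists (`|a| + Z); first by rewrite addr_ge0.
move=> v /=; rewrite in_cons => /orP[/eqP ->|/sZ /andP[v1 v2]].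
  by rewrite -ler_norml lerDl.
by have := normr_ge0 a => a0; apply/andP; split; lra.
Qed.

Section Stability.
Context (R : realType).
Variables (B C : multiset (nitv R)) (b c q : R -> R -> nat).
Variables (delta eta : R) (L : nat).
Hypothesis delta_ge0 : 0 <= delta.
Hypothesis eta_gt0 : 0 < eta.
Hypothesis L_eta : L%:R * eta = 2 * delta.
Hypothesis ri : rank_interleaved delta b c q.
Hypothesis B_b : bar_counts B b.
Hypothesis C_c : bar_counts C c.

Definition bars_close (x : midx B) (y : midx C) : Prop :=
  eclose (delta + eta) (itv_birth (B x)) (itv_birth (C y)) /\
  eclose (delta + eta) (itv_death (B x)) (itv_death (C y)).

(** With [S] the set of anchors, these bars include every possible partner of an anchored bar. *)
Let cand (D : multiset (nitv R)) (S : set R) : set (midx D) :=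
  \bigcup_(s in S) [set x | s \in nitv_val (D x)].

Let cand_finite D d (S : set R) : bar_counts D d -> finite_set S ->
  finite_set (@cand D S).
Proof.
move=> Dd Sfin; apply: bigcup_finite => // s _.
apply: sub_finite_set (enumerates_finite (Dd _ _ (lexx s))).
by move=> x /= xs.
Qed.

(* The default value of fine on infinite endpoints only adds the point 0. *)
Let ends (D : multiset (nitv R)) (S : set R) : set R :=
  ((fun x => fine (itv_birth (D x))) @` @cand D S) `|`
  ((fun x => fine (itv_death (D x))) @` @cand D S).

Let ends_finite D d (S : set R) : bar_counts D d -> finite_set S ->
  finite_set (@ends D S).
Proof.
move=> Dd Sfin; rewrite finite_setU.
by split; apply: finite_image; apply: cand_finite Dd Sfin.
Qed.

(** Partners must contain the anchors, so the bars whose endpoints matter are known and finite in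
    number before any matching is made; the grid is chosen wide enough for all of them. *)
Lemma finite_bar_matching (pB : midx B -> R) (pC : midx C -> R)
    (F : set (midx B)) (G : set (midx C)) : finite_set F -> finite_set G ->
  exists sigma : midx B -> midx C -> Prop,
  [/\ partial_bij sigma,
      forall x, F x -> deep (delta + eta) (B x) (pB x) ->
        exists y, [/\ sigma x y, bars_close x y & pB x \in nitv_val (C y)]
    & forall y, G y -> deep (delta + eta) (C y) (pC y) ->
        exists x, [/\ sigma x y, bars_close x y & pC y \in nitv_val (B x)]].
Proof.
move=> Ffin Gfin.
have d0 : 0 <= delta by [].
have e0 : 0 < eta by [].
pose S := (pB @` F) `|` (pC @` G).
have Sfin : finite_set S by rewrite finite_setU; split; exact: finite_image.
have [Z Z0 HZ] : exists2 Z, 0 <= Z &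
    forall v, (S `|` (ends B S `|` ends C S)) v -> - Z <= v <= Z.
  apply: finite_set_bounded; rewrite finite_setU; split => //.
  rewrite finite_setU.
  by split; [exact: ends_finite B_b Sfin|exact: ends_finite C_c Sfin].
pose g0 := - Z - 4 * delta - 4 * eta - 1.
(* The number of steps of size [eta] from [g0] to beyond [Z + 4 * delta + 4 * eta]. *)
pose w := (2 * Z + 8 * delta + 8 * eta + 2) / eta.
have w0 : 0 <= w by apply: divr_ge0; [lra|exact: ltW].
pose n := Num.bound w.
have gn : Z + 4 * delta + 4 * eta < grid g0 eta n.
  have : w * eta < n%:R * eta by rewrite ltr_pM2r // archi_boundP.
  by rewrite /w divfK ?gt_eqF // /grid /g0; lra.
have lo0 : g0 + 4 * delta + 4 * eta < - Z by rewrite /g0; lra.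
have g1 : grid g0 eta 1 = g0 + eta by rewrite /grid mul1r.
have gS m : grid g0 eta m.+1 = grid g0 eta m + eta by rewrite gridS.
have g'S m : shifted_grid g0 eta delta m.+1 = shifted_grid g0 eta delta m + eta.
  by rewrite /shifted_grid gS addrAC.
have gL m : grid g0 eta (m + L) = grid g0 eta m + 2 * delta by rewrite (gridL _ L_eta).
have [sigma [sbij sE sB sC]] := grid_bar_matching g0 n eta_gt0 L_eta ri B_b C_c.
have endsZ (D : multiset (nitv R)) x :
    @ends D S `<=` ends B S `|` ends C S -> @cand D S x ->
    (forall r, itv_birth (D x) = r%:E -> - Z <= r) /\
    (forall r, itv_death (D x) = r%:E -> r <= Z).
  move=> DS xD; split => r rE.
    suff : - Z <= r <= Z by case/andP.
    by apply: HZ; right; apply: DS; left; exists x => //; rewrite rE.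
  suff : - Z <= r <= Z by case/andP.
  by apply: HZ; right; apply: DS; right; exists x => //; rewrite rE.
have close x y : sigma x y -> @cand B S x -> @cand C S y -> bars_close x y.
  move=> /sE[i [j [i' [j' [labx laby ii' jj']]]]].
  move=> xB yC; have [bx dx] := endsZ B x (@subsetUl _ _ _) xB.
  have [b_y d_y] := endsZ C y (@subsetUr _ _ _) yC.
  split.
    exact: (@label_eclose_birth _ _ _ _ _ _ (- Z) _ _ _ _ _ _ d0 e0 L_eta labx laby).
  exact: (@label_eclose_death _ _ _ _ _ _ Z _ _ _ _ _ _ d0 e0 L_eta labx laby).
have Zp p : S p -> - Z <= p <= Z by move=> Sp; apply: HZ; left.
have r0 : 0 <= delta + eta by lra.
have er : eta <= delta + eta by lra.
exists sigma; split => //.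
- move=> x Fx deepx; set p := pB x.
  have Sp : S p by left; exists x.
  have /andP[p1 p2] := Zp _ Sp.
  have pn : p + delta < grid g0 eta n by lra.
  have p1' : grid g0 eta 1 + delta < p by rewrite g1; lra.
  have [i [j lab]] : exists i j, grid_label (grid g0 eta) n (B x) i j.
    by apply: (deep_label_ex e0 gS er deepx); rewrite -/p; lra.
  have pi := label_birth_lt e0 gS lab deepx.1 p1'.
  have pj := label_death_gt e0 gS lab deepx.2 pn.
  rewrite -/p in pi pj.
  (* The labels lie more than [delta] on either side of [p], hence at least [L] steps apart. *)
  have [|y sxy] := sB x i j lab.
    apply: ltnW; rewrite -(grid_lt g0 e0) gL; lra.
  have [i2 [j2 [i' [j' [lab2 laby ii' jj']]]]] := sE _ _ sxy.
  have [Ei Ej] := grid_label_uniq lab2 lab; subst i2 j2.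
  have [yi yj] := grid_label_mem laby.
  (* The labels of [y] still enclose [p] after moving inwards by at most [delta]. *)
  have py : p \in nitv_val (C y).
    apply: mem_nitv_between yi yj; rewrite /shifted_grid.
      have : grid g0 eta i' <= grid g0 eta i by apply: grid_le => //; case/andP: ii'.
      lra.
    have : grid g0 eta j <= grid g0 eta (j' + L).
      by apply: grid_le => //; case/andP: jj'.
    rewrite gL; lra.
  exists y; split => //; apply: close => //; last by exists p.
  by exists p => //; exact: deep_mem r0 deepx.
- move=> y Gy deepy; set p := pC y.
  have Sp : S p by right; exists y.
  have /andP[p1 p2] := Zp _ Sp.
  have pn : p + delta < shifted_grid g0 eta delta n by rewrite /shifted_grid; lra.
  have p1' : shifted_grid g0 eta delta 1 + delta < p by rewrite /shifted_grid g1; lra.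
  have [i' [j' lab]] : exists i j,
      grid_label (shifted_grid g0 eta delta) n (C y) i j.
    by apply: (deep_label_ex e0 g'S er deepy); rewrite /shifted_grid -/p; lra.
  have := label_birth_lt e0 g'S lab deepy.1 p1'; rewrite /shifted_grid => pi.
  have := label_death_gt e0 g'S lab deepy.2 pn; rewrite /shifted_grid => pj.
  rewrite -/p in pi pj.
  have [|x sxy] := sC y i' j' lab.
    apply: ltnW; rewrite -(grid_lt g0 e0) gL; lra.
  have [i [j [i2 [j2 [labx lab2 ii' jj']]]]] := sE _ _ sxy.
  have [Ei Ej] := grid_label_uniq lab2 lab; subst i2 j2.
  have [xi xj] := grid_label_mem labx.
  have px : p \in nitv_val (B x).
    apply: mem_nitv_between xi xj.
      have : grid g0 eta i <= grid g0 eta (i' + L).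
        by apply: grid_le => //; case/andP: ii'.
      rewrite gL; lra.
    have : grid g0 eta j' <= grid g0 eta j by apply: grid_le => //; case/andP: jj'.
    lra.
  exists x; split => //; apply: close => //; first by exists p.
  by exists p => //; exact: deep_mem r0 deepy.
Qed.

(** An ultrafilter that contains a finite union contains one of its members. *)
Lemma ultra_exists (T : Type) (U : set_system T) n (A : 'I_n -> set T) :
  UltraFilter U -> U (fun D => exists l, A l D) -> exists l, U (A l).
Proof.
move=> UU UA; apply: contrapT => nA.
have : U (fun D => forall l, ~ A l D).
  apply: filter_forall => l; have [UAl|//] := in_ultra_setVsetC (A l) UU.
  by case: nA; exists l.
move=> nUA; have [D [[l Al] nAl]] := filter_ex (filterI UA nUA).
exact: nAl Al.
Qed.

Theorem rank_interleaved_matching :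
  exists sigma : midx B -> midx C -> Prop, matching (delta + eta) sigma.
Proof.
have r0 : 0 <= delta + eta by rewrite addr_ge0 // ltW.
have deep_fun (D : multiset (nitv R)) : exists p : midx D -> R, forall x,
    ~ (itv_death (D x) <= itv_birth (D x) + (2 * (delta + eta))%:E)%E ->
    deep (delta + eta) (D x) (p x).
  suff /choice[p pE] : forall x, exists p,
      ~ (itv_death (D x) <= itv_birth (D x) + (2 * (delta + eta))%:E)%E ->
      deep (delta + eta) (D x) p by exists p.
  move=> x; have [?|/(deep_ex r0)[p xp]] := pselect
    (itv_death (D x) <= itv_birth (D x) + (2 * (delta + eta))%:E)%E.
    by exists 0.
  by exists p.
have [pB pBdeep] := deep_fun B; have [pC pCdeep] := deep_fun C.
pose T := (set (midx B) * set (midx C))%type.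
have /choice[s sE] (D : T) : exists sigma : midx B -> midx C -> Prop,
    finite_set D.1 -> finite_set D.2 -> [/\ partial_bij sigma,
      forall x, D.1 x -> deep (delta + eta) (B x) (pB x) ->
        exists y, [/\ sigma x y, bars_close x y & pB x \in nitv_val (C y)]
    & forall y, D.2 y -> deep (delta + eta) (C y) (pC y) ->
        exists x, [/\ sigma x y, bars_close x y & pC y \in nitv_val (B x)]].
  have [[f1 f2]|nf] := pselect (finite_set D.1 /\ finite_set D.2).
    by have [sigma ?] := finite_bar_matching pB pC f1 f2; exists sigma.
  by exists (fun _ _ => False) => f1 f2; case: nf.
(* Cones over pairs of finite sets generate a proper filter, since such pairs are directed under
   union. *)
pose cone (D0 : T) : set T := [set D | [/\ finite_set D.1, finite_set D.2,
  D0.1 `<=` D.1 & D0.2 `<=` D.2]].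
pose FF : set_system T := [set A | exists D0 : T,
  [/\ finite_set D0.1, finite_set D0.2 & cone D0 `<=` A]].
have FFfilter : ProperFilter FF.
  split.
    by move=> [D [f1 f2 /(_ D)]]; apply; split.
  split.
  - by exists (set0, set0); split.
  - move=> P Q [D [f1 f2 DP]] [E [g1 g2 EQ]].
    exists (D.1 `|` E.1, D.2 `|` E.2); rewrite !finite_setU; split => //.
    move=> H [h1 h2 /=]; rewrite !subUset => -[s1 s2] [t1 t2].
    by split; [apply: DP|apply: EQ]; split.
  - move=> P Q PQ [D [f1 f2 DP]]; exists D; split => //.
    exact: subset_trans DP PQ.
have [U [UU FU]] := ultraFilterLemma FFfilter.
have Ucone D0 : finite_set D0.1 -> finite_set D0.2 -> U (cone D0).
  by move=> f1 f2; apply: FU; exists D0; split.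
have Ufin : U (cone (set0, set0)) by exact: Ucone.
(* The limit matching: pairs matched for almost every finite stage. *)
exists (fun x y => U (fun D => s D x y /\ bars_close x y)); split.
- split.
    move=> x y y' /(filterI Ufin) xy xy'.
    have [D [[[f1 f2 _ _] [sxy _]] [sxy' _]]] := filter_ex (filterI xy xy').
    by have [[bij _] _ _] := sE D f1 f2; exact: bij sxy sxy'.
  move=> x x' y /(filterI Ufin) xy xy'.
  have [D [[[f1 f2 _ _] [sxy _]] [sxy' _]]] := filter_ex (filterI xy xy').
  by have [[_ bij] _ _] := sE D f1 f2; exact: bij sxy sxy'.
- by move=> x y /filter_ex[D [_]].
- move=> x nx; apply: contrapT => /pBdeep deepx; apply: nx.
  (* At every stage beyond [x] its partner contains [pB x]; there are finitely many such bars, so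
     one of them is the partner almost always. *)
  have [h h_inj hE] := C_c (lexx (pB x)).
  have [|l Ul] := @ultra_exists _ U _
      (fun l D => s D x (h l) /\ bars_close x (h l)) UU; last by exists (h l).
  apply: filterS (Ucone ([set x], set0) (finite_set1 _) (finite_set0 _)).
  move=> D [f1 f2 /= /(_ x erefl) Dx _].
  have [_ /(_ x Dx deepx)[y [sxy cxy py]] _] := sE D f1 f2.
  have /hE[l yl] : [set i | pB x \in nitv_val (C i) /\ pB x \in nitv_val (C i)] y.
    by [].
  by exists l; rewrite -yl.
- move=> y ny; apply: contrapT => /pCdeep deepy; apply: ny.
  have [h h_inj hE] := B_b (lexx (pC y)).
  have [|l Ul] := @ultra_exists _ U _
      (fun l D => s D (h l) y /\ bars_close (h l) y) UU; last by exists (h l).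
  apply: filterS (Ucone (set0, [set y]) (finite_set0 _) (finite_set1 _)).
  move=> D [f1 f2 /= _ /(_ y erefl) Dy].
  have [_ _ /(_ y Dy deepy)[x [sxy cxy px]]] := sE D f1 f2.
  have /hE[l xl] : [set i | pC y \in nitv_val (B i) /\ pC y \in nitv_val (B i)] x.
    by [].
  by exists l; rewrite -xl.
Qed.

End Stability.

(** * Restriction to a line *)

Section Line.
Context (R : realType) (d : nat) (k : fieldType).
Implicit Types (l : uline R d) (M N : persmod k ('I_d -> R)).

Lemma uline_ptD l (s t : R) i :
  uline_pt l t i - uline_pt l s i = (t - s) * (uline_dst l i - uline_src l i).
Proof. rewrite /uline_pt; ring. Qed.

Lemma uline_weight_le l i : uline_max l = 1 ->
  uline_weight l <= uline_dst l i - uline_src l i.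
Proof.
by move=> l1; rewrite /uline_weight l1 divr1; exact: bigmin_le.
Qed.

Lemma uline_weight_gt0 l : uline_max l = 1 -> 0 < uline_weight l.
Proof.
move=> l1; rewrite /uline_weight l1 divr1; apply: lt_bigmin; first by rewrite l1.
by move=> i _; rewrite subr_gt0 uline_lt.
Qed.

(** On a normalized line the weight is the least slope, so advancing the parameter by [delta] raises
    every coordinate by at least [e]. *)
Lemma uline_pt_shift l e delta (s t : R) : uline_max l = 1 -> 0 <= delta ->
  e <= uline_weight l * delta -> s + delta <= t ->
  (translate (diag e) (uline_pt l s) <= uline_pt l t :> ('I_d -> R))%O.
Proof.
move=> l1 d0 ed st; apply/lefP => i; rewrite /translate /diag.
rewrite -lerBrDl uline_ptD; apply: le_trans ed _; rewrite mulrC.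
apply: ler_pM => //; first exact/ltW/uline_weight_gt0.
  by lra.
exact: uline_weight_le.
Qed.

Definition lin_comp (U V W : lmodType k) (f : {linear V -> W})
  (g : {linear U -> V}) : {linear U -> W} := f \o g.

Lemma pmor_trans (disp : Order.disp_t) (T : porderType disp) (M : persmod k T)
    (s t u : T) (st : (s <= t)%O) (tu : (t <= u)%O) (su : (s <= u)%O) x :
  pmor M tu (pmor M st x) = pmor M su x.
Proof. exact/esym/pmor_comp. Qed.

Lemma pmor_trans3 (disp : Order.disp_t) (T : porderType disp) (M : persmod k T)
    (s t u v : T) (st : (s <= t)%O) (tu : (t <= u)%O) (uv : (u <= v)%O)
    (sv : (s <= v)%O) x :
  pmor M uv (pmor M tu (pmor M st x)) = pmor M sv x.
Proof. by rewrite (pmor_trans st tu (le_trans st tu)); exact: pmor_trans. Qed.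

(** Follow each interleaving map by the structure map from the diagonal translate up to the point
    [delta] further along the line. *)
Lemma interleaved_line l e delta M N : uline_max l = 1 ->
  0 <= e -> 0 <= delta -> e <= uline_weight l * delta -> interleaved e M N ->
  line_interleaved delta (prestrict l M) (prestrict l N).
Proof.
move=> l1 e0 d0 ed [f [g [gf fg]]].
have le2 (s : 'I_d -> R) : (s <= translate (diag e) (translate (diag e) s))%O.
  by apply/lefP => i; rewrite /translate /diag -addrA lerDl addr_ge0.
pose f' s t (h : s + delta <= t) : {linear prestrict l M s -> prestrict l N t} :=
  lin_comp (pmor N (uline_pt_shift l1 d0 ed h)) (f (uline_pt l s)).
pose g' s t (h : s + delta <= t) : {linear prestrict l N s -> prestrict l M t} :=
  lin_comp (pmor M (uline_pt_shift l1 d0 ed h)) (g (uline_pt l s)).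
exists f', g'; split.
- move=> s' s t ss h h' x; rewrite /f' /= (phom_nat f) /=.
  exact: pmor_trans.
- by move=> s t t' tt h h' x; rewrite /f' /=; exact: pmor_trans.
- move=> s t u h h' su x; rewrite /f' /g' /= (phom_nat g) /=.
  by rewrite (gf _ (le2 _)); exact: pmor_trans3.
- move=> s t u h h' su x; rewrite /f' /g' /= (phom_nat f) /=.
  by rewrite (fg _ (le2 _)); exact: pmor_trans3.
Qed.

End Line.

(** * Bars of rectangles along a line *)

Lemma mulmx_onesK (k : fieldType) (a b : bool) (x : 'rV[k]_a) : a = b ->
  x *m (const_mx 1 : 'M_(a, b)) *m (const_mx 1 : 'M_(b, a)) = x.
Proof.
move=> ab; case: b / ab; case: a x => x; last by apply/rowP => -[].
by apply/rowP => i; rewrite (ord1 i) !mxE big_ord1 !mxE big_ord1 !mxE !mulr1.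
Qed.

Lemma ones_mulmx (k : fieldType) (a b c : bool) : (a -> c -> b) ->
  (const_mx 1 : 'M[k]_(a, b)) *m (const_mx 1 : 'M_(b, c)) = const_mx 1.
Proof.
case: a => acb; last by apply/matrixP => -[].
case: c acb => acb; last by apply/matrixP => i -[].
case: b acb => [_|/(_ isT isT)//].
by apply/matrixP => i j; rewrite !mxE big_ord1 !mxE mulr1.
Qed.

Lemma enumerates_sum (T T' : Type) (D : set T) (D' : set T') n n' :
  enumerates D n -> enumerates D' n' ->
  enumerates [set x : T + T' | match x with inl i => D i | inr j => D' j end]
    (n + n').
Proof.
move=> [h h_inj hD] [h' h'_inj hD'].
exists (fun i => match fintype.split i with
  | inl a => inl (h a) | inr a => inr (h' a) end).
  move=> i j; rewrite -[i]fintype.splitK -[j]fintype.splitK.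
  case: (fintype.split i) (fintype.split j) => [a|a] [a'|a'];
    rewrite !fintype.unsplitK // => -[] E; congr unsplit.
    by rewrite (h_inj _ _ E).
  by rewrite (h'_inj _ _ E).
move=> [x|x] /=.
  rewrite hD; split=> [[a ->]|[i]].
    by exists (lshift n' a); rewrite (fintype.unsplitK (inl a)).
  by case: (fintype.split i) => // a [->]; exists a.
rewrite hD'; split=> [[a ->]|[i]].
  by exists (rshift n a); rewrite (fintype.unsplitK (inr a)).
by case: (fintype.split i) => // a [->]; exists a.
Qed.

Lemma enumerates_sig (T : Type) (N D : set T) n : D `<=` N ->
  enumerates D n -> enumerates [set w : {x | N x} | D (sval w)] n.
Proof.
move=> DN [h h_inj hD].
have hN i : N (h i) by apply/DN/hD; exists i.
exists (fun i => exist _ (h i) (hN i)); first by move=> i j [] /h_inj.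
move=> [x xN] /=; rewrite hD; split=> -[i].
  by move=> xi; subst x; exists i; congr exist; exact: Prop_irrelevance.
by move=> [->]; exists i.
Qed.

Section LineBars.
Context (R : realType) (d : nat) (k : fieldType) (l : uline R d).
Variables (Rs Ss : multiset (rect R d)).

Let Q (x : midx Rs + midx Ss) : rect R d :=
  match x with inl i => Rs i | inr j => Ss j end.

Definition line_trace (x : midx Rs + midx Ss) : set R :=
  [set y | rect_set (Q x) (uline_pt l y)].

Let trace_idx := {x | line_trace x !=set0}.

(** The trace of a rectangle on the line is convex, hence an interval. *)
Lemma line_traceE x : [set` Rhull (line_trace x)] = line_trace x.
Proof.
symmetry; apply/is_intervalP => a c Qa Qc y /andP[ay yc].
by apply: rect_oconvex Qa Qc; apply: uline_pt_homo.
Qed.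

Definition line_bar (w : trace_idx) : nitv R :=
  @NItv R (Rhull (line_trace (sval w)))
    (eq_ind_r (fun A => A !=set0) (svalP w) (line_traceE (sval w))).

(* The rectangles that do not meet the line are discarded, since bars are
   non-empty. *)
Definition line_bars : multiset (nitv R) := Multiset line_bar.

Lemma mem_line_bar (w : midx line_bars) y :
  (y \in nitv_val (line_bars w)) = (uline_pt l y \in rect_set (Q (sval w))).
Proof.
apply/idP/idP => [yw|/set_mem yw].
  apply/mem_set; have : [set` Rhull (line_trace (sval w))] y by [].
  by rewrite line_traceE.
have : line_trace (sval w) y by [].
by rewrite -line_traceE.
Qed.

(** A rectangle counted at [s] and [t] meets the line, so discarding the others changes no count. *)
Lemma line_bars_counts n n' :
  (forall s t, s <= t -> enumerates [set i : midx Rs |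
     rect_set (Rs i) (uline_pt l s) /\ rect_set (Rs i) (uline_pt l t)] (n s t)) ->
  (forall s t, s <= t -> enumerates [set i : midx Ss |
     rect_set (Ss i) (uline_pt l s) /\ rect_set (Ss i) (uline_pt l t)] (n' s t)) ->
  bar_counts line_bars (fun s t => n s t + n' s t)%N.
Proof.
move=> Rn Sn s t st; have := enumerates_sum (Rn s t st) (Sn s t st).
set D := (X in enumerates X _) => /enumerates_sig-/(_ (fun x => line_trace x !=set0)).
have DN : D `<=` (fun x => line_trace x !=set0) by move=> [i|i] [Ds _]; exists s.
move=> /(_ DN); congr enumerates; apply/seteqP.
have E (w : midx line_bars) : D (sval w) = (rect_set (Q (sval w)) (uline_pt l s) /\
    rect_set (Q (sval w)) (uline_pt l t)) by case: w => -[].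
split=> w /=; rewrite E !mem_line_bar.
  by move=> [? ?]; split; exact/mem_set.
by move=> [/set_mem ? /set_mem ?].
Qed.

Let M := prestrict l (padd (krect k Rs) (krect k Ss)).
Let N := kbars k line_bars.

Let comp (s : R) (u : M s) (x : midx Rs + midx Ss) :
    'rV[k]_(uline_pt l s \in rect_set (Q x)) :=
  match x return 'rV[k]_(uline_pt l s \in rect_set (Q x)) with
  | inl i => (u.1 : dsum _) i
  | inr j => (u.2 : dsum _) j
  end.

Let comp_linear s x : linear (fun u => @comp s u x).
Proof. by case: x. Qed.

Let compP s (u v : M s) : (forall x, comp u x = comp v x) -> u = v.
Proof.
case: u v => [u1 u2] [v1 v2] E; congr pair.
  by apply: dsum_eq => i; exact: (E (inl i)).
by apply: dsum_eq => i; exact: (E (inr i)).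
Qed.

Let sval_inj (w w' : trace_idx) : sval w = sval w' -> w = w'.
Proof.
by case: w w' => [x hx] [x' hx'] /= E; subst x'; congr exist; exact: Prop_irrelevance.
Qed.

Let comp_fin s (u : M s) : finite_set [set x | comp u x <> 0].
Proof.
apply: (@sub_finite_set _ _ (inl @` [set i | (u.1 : dsum _) i <> 0] `|`
                            inr @` [set j | (u.2 : dsum _) j <> 0])).
  by move=> [i|j] /= ne; [left; exists i|right; exists j].
by rewrite finite_setU; split; apply: finite_image; exact: dsum_fin.
Qed.

(** The matrix of ones serves as a cast: its two sizes are equal, but not by conversion. *)
Program Definition to_bars_fun (s : R) (u : M s) : N s :=
  @DSum k trace_idx (fun w => kmod k (@nitv_oconvex R (line_bar w)) s)
    (fun w => comp u (sval w) *m const_mx 1) _.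
Next Obligation.
move=> s u; have : finite_set [set w : trace_idx | comp u (sval w) <> 0].
  apply: (@finite_preimage _ _ [set x | comp u x <> 0] sval) (comp_fin u).
  by move=> w w' _ _; exact: sval_inj.
by apply: sub_finite_set => w /= + E; apply; rewrite E mul0mx.
Qed.

Fact to_bars_is_linear s : linear (@to_bars_fun s).
Proof.
move=> a u v; apply: dsum_eq => w /=.
by rewrite (comp_linear (sval w) a u v) mulmxDl scalemxAl.
Qed.

HB.instance Definition _ s :=
  GRing.isLinear.Build k (M s) (N s) *:%R (@to_bars_fun s) (@to_bars_is_linear s).

Let mem_line_bar_set (w : trace_idx) y :
  (y \in [set` nitv_val (line_bar w)]) = (uline_pt l y \in rect_set (Q (sval w))).
Proof.
rewrite -(mem_line_bar w); apply/idP/idP => [/set_mem //|yw].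
exact/mem_set.
Qed.

Fact to_bars_nat s t (st : (s <= t)%O) (u : M s) :
  to_bars_fun (pmor M st u) = pmor N st (to_bars_fun u).
Proof.
apply: dsum_eq => w /=.
have -> : comp (pmor M st u) (sval w) = comp u (sval w) *m const_mx 1.
  by case: (sval w).
rewrite -!mulmxA; congr (_ *m _).
by rewrite !ones_mulmx // !mem_line_bar_set.
Qed.

Definition to_bars : phom M N := @PHom _ _ _ M N
  (fun s => @to_bars_fun s : {linear M s -> N s}) to_bars_nat.

(** The default 0 is forced: if the rectangle misses the line, the component space is zero. *)
Let from_comp s (v : N s) (x : midx Rs + midx Ss) :
    'rV[k]_(uline_pt l s \in rect_set (Q x)) :=
  if pselect (line_trace x !=set0) is left h
  then (v : dsum _) (exist _ x h) *m const_mx 1 else 0.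

Let from_comp_fin s (v : N s) : finite_set [set x | from_comp v x <> 0].
Proof.
apply: (@sub_finite_set _ _ (@sval _ _ @` [set w : trace_idx | (v : dsum _) w <> 0])).
  move=> x /=; rewrite /from_comp; case: pselect => // h vx.
  by exists (exist _ x h) => //= v0; apply: vx; rewrite v0 mul0mx.
exact/finite_image/dsum_fin.
Qed.

Program Definition from_bars s (v : N s) : M s :=
  (@DSum k _ (fun i => kmod k (@rect_oconvex R d (Rs i)) (uline_pt l s))
     (fun i => from_comp v (inl i)) _,
   @DSum k _ (fun j => kmod k (@rect_oconvex R d (Ss j)) (uline_pt l s))
     (fun j => from_comp v (inr j)) _).
Next Obligation.
move=> s v.
apply: (@finite_preimage _ _ [set x | from_comp v x <> 0] inl) (from_comp_fin v).
by move=> i j _ _ [].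
Qed.
Next Obligation.
move=> s v.
apply: (@finite_preimage _ _ [set x | from_comp v x <> 0] inr) (from_comp_fin v).
by move=> i j _ _ [].
Qed.

Lemma is_barcode_line_bars : is_barcode M line_bars.
Proof.
exists to_bars => s; exists (@from_bars s) => [u|v].
  apply: compP => x.
  have -> : comp (from_bars (to_bars s u)) x = from_comp (to_bars s u) x by case: x.
  rewrite /from_comp; case: pselect => [h|h] /=.
    exact/mulmx_onesK/esym/(mem_line_bar_set (exist _ x h)).
  have : ~~ (uline_pt l s \in rect_set (Q x)).
    by apply/negP => /set_mem xs; apply: h; exists s.
  move: (comp u x); case: (_ \in rect_set (Q x)) => // y _.
  by apply/rowP => -[].
apply: dsum_eq => -[x h] /=.
have -> : comp (from_bars v) x = from_comp v x by case: x {h}.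
rewrite /from_comp; case: pselect => // h'; rewrite (Prop_irrelevance h' h).
exact/mulmx_onesK/(mem_line_bar_set (exist _ x h)).
Qed.

End LineBars.

(** * Matching distance *)

Lemma Rk_finite_pfd (k : fieldType) (disp : Order.disp_t) (T : porderType disp)
  (M : persmod k T) : Rk_finite M -> pfd M.
Proof.
by move=> fM s; apply: finite_dim_rank_id (fM s s (lexx s)) => x; rewrite pmor_id.
Qed.

Section Assembly.
Context (R : realType) (k : fieldType) (d : nat).
Variables (M M' : persmod k ('I_d -> R)).
Hypotheses (hM : pfd M) (hM' : pfd M').
Variables (Rs Ss Rs' Ss' : multiset (rect R d)).
Hypothesis hRS : rank_decomposition M Rs Ss.
Hypothesis hRS' : rank_decomposition M' Rs' Ss'.
Variable l : uline R d.
Hypothesis l1 : uline_max l = 1.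

Let line_rank (Q : multiset (rect R d)) := total_rank (prestrict l (krect k Q)).

Let line_rank_enumerates Q : Rk_finite (krect k Q) -> forall s t, s <= t ->
  enumerates [set i : midx Q | rect_set (Q i) (uline_pt l s) /\
                               rect_set (Q i) (uline_pt l t)] (line_rank Q s t).
Proof.
move=> finQ s t st; rewrite /line_rank (total_rankE _ st).
exact: (@Rk_psum_kmod k _ _ _ (fun i => rect_set (Q i))
  (fun i => @rect_oconvex R d (Q i)) _ _ (uline_pt_homo l st) (finQ _ _ _)).
Qed.

Let line_rank_decomposition (N : persmod k ('I_d -> R)) As Bs :
  rank_decomposition N As Bs ->
  forall s t, s <= t ->
  line_rank As s t = (total_rank (prestrict l N) s t + line_rank Bs s t)%N.
Proof.
move=> [_ _ E] s t st; rewrite /line_rank !(total_rankE _ st).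
have : (Rk (prestrict l N) st)%:Z = (Rk (prestrict l (krect k As)) st)%:Z -
  (Rk (prestrict l (krect k Bs)) st)%:Z := E _ _ (uline_pt_homo l st).
lia.
Qed.

(** By the two rank decompositions, these bars count the ranks of [M] and of [M'], each increased by
    those of the modules of [Ss] and [Ss']. *)
Lemma line_bars_matching e eps : 0 <= e -> 0 < eps -> interleaved e M M' ->
  exists sigma : midx (line_bars l Rs Ss') -> midx (line_bars l Rs' Ss) -> Prop,
    matching (e / uline_weight l + eps) sigma.
Proof.
move=> e0 eps0 MM'; have w0 := uline_weight_gt0 l1.
have [fR fS E] := hRS; have [fR' fS' E'] := hRS'.
(* Half of [eps] keeps [delta] positive even when [e = 0]; the other half bounds the grid step
   [eta], through the choice of [L]. *)
pose delta := e / uline_weight l + eps / 2.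
have ew0 : 0 <= e / uline_weight l by apply: divr_ge0 => //; exact: ltW.
have d0 : 0 <= delta by rewrite /delta; lra.
have ed : e <= uline_weight l * delta.
  by rewrite /delta mulrDr mulrC divfK ?gt_eqF // lerDl mulr_ge0 //; [exact: ltW|lra].
pose L := Num.bound (4 * delta / eps).
have Lb : 4 * delta / eps < L%:R.
  by apply: archi_boundP; apply: divr_ge0; [lra|exact: ltW].
have dpos : 0 < delta by rewrite /delta; lra.
have L0 : 0 < L%:R :> R by apply: le_lt_trans Lb; apply: divr_ge0; [lra|exact: ltW].
pose eta := 2 * delta / L%:R.
have eta0 : 0 < eta by apply: divr_gt0 => //; lra.
have L_eta : L%:R * eta = 2 * delta by rewrite /eta mulrC divfK // gt_eqF.
have eta_eps : eta <= eps / 2.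
  rewrite /eta ler_pdivrMr //; have := Lb; rewrite ltr_pdivrMr // => Lb'; lra.
have pfdl (N : persmod k ('I_d -> R)) : 
    pfd N -> pfd (prestrict l N) by move=> fN s; exact: fN.
have [q riM] := line_interleaved_rank d0 (pfdl _ hM) (pfdl _ hM')
  (interleaved_line l1 e0 d0 ed MM').
(* The added summands are interleaved with themselves. *)
have [qS riS] := line_interleaved_rank d0 (pfdl _ (Rk_finite_pfd fS))
  (pfdl _ (Rk_finite_pfd fS)) (line_interleaved_refl (prestrict l (krect k Ss)) d0).
have [qS' riS'] := line_interleaved_rank d0 (pfdl _ (Rk_finite_pfd fS'))
  (pfdl _ (Rk_finite_pfd fS')) (line_interleaved_refl (prestrict l (krect k Ss')) d0).
have ri := rank_interleavedD riM (rank_interleavedD riS riS').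
have [||sigma sm] := @rank_interleaved_matching R (line_bars l Rs Ss')
    (line_bars l Rs' Ss) _ _ _ delta eta L d0 eta0 L_eta ri.
- move=> s t st; have := line_bars_counts (line_rank_enumerates fR)
    (line_rank_enumerates fS') st.
  by rewrite (line_rank_decomposition hRS) // addnA.
- move=> s t st; have := line_bars_counts (line_rank_enumerates fR')
    (line_rank_enumerates fS) st.
  by rewrite (line_rank_decomposition hRS') // -addnA [(line_rank Ss' s t + _)%N]addnC.
exists sigma; case: sm => s1 s2 s3 s4.
have le_eps : delta + eta <= e / uline_weight l + eps by rewrite /delta; lra.
have eclose_le x y : eclose (delta + eta) x y ->
    eclose (e / uline_weight l + eps) x y.
  move=> [xy yx]; split.
    by apply: le_trans xy _; rewrite leeD2l // lee_fin.
  by apply: le_trans yx _; rewrite leeD2l // lee_fin.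
split => //.
- by move=> i j /s2[/eclose_le ? /eclose_le].
- move=> i /s3 /le_trans; apply; rewrite leeD2l // lee_fin ler_pM2l //.
- move=> j /s4 /le_trans; apply; rewrite leeD2l // lee_fin ler_pM2l //.
Qed.

Lemma weighted_d_b_le e : 0 <= e -> interleaved e M M' ->
  ((uline_weight l)%:E *
   d_b (prestrict l (padd (krect k Rs) (krect k Ss')))
       (prestrict l (padd (krect k Rs') (krect k Ss))) <= e%:E)%E.
Proof.
move=> e0 MM'; have w0 := uline_weight_gt0 l1.
set D := d_b _ _; have De : (D <= (e / uline_weight l)%:E)%E.
  apply/lee_addgt0Pr => eps eps0; have [sigma sm] := line_bars_matching e0 eps0 MM'.
  apply: ge_ereal_inf; exists (bottleneck (line_bars l Rs Ss') (line_bars l Rs' Ss)).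
    by exists (line_bars l Rs Ss'), (line_bars l Rs' Ss); split => //;
      exact: is_barcode_line_bars.
  apply: ge_ereal_inf; exists (e / uline_weight l + eps)%:E; last by rewrite EFinD.
  exists (e / uline_weight l + eps) => //; split; last by exists sigma.
  by apply: addr_ge0; [apply: divr_ge0 => //; exact: ltW|exact: ltW].
have -> : e = uline_weight l * (e / uline_weight l) by rewrite mulrC divfK ?gt_eqF.
by rewrite EFinM; apply: lee_wpmul2l De; rewrite lee_fin ltW.
Qed.

End Assembly.

Theorem mainTheorem3 (R : realType) (k : fieldType) (d : nat)
    (M M' : persmod k ('I_d -> R)) (hM : pfd M) (hM' : pfd M')
    (Rs Ss Rs' Ss' : multiset (rect R d))
    (hRS : rank_decomposition M Rs Ss)
    (hRS' : rank_decomposition M' Rs' Ss') :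
  (d_match (padd (krect k Rs) (krect k Ss')) (padd (krect k Rs') (krect k Ss))
     <= d_i M M')%E.
Proof.
apply/ereal_infP => _ [e [e0 MM'] <-]; apply/ereal_supP => _ [l l1 <-].
exact: (weighted_d_b_le hM hM' hRS hRS' l1).
Qed.
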